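(* Let $\Omega=[0,1]^2$, let $A_1\in L^\infty(\Omega;\mathbb{R}^{2\times 2})$ be symmetric, $\Omega$-periodic and uniformly elliptic with constants $0<\alpha\le\beta$, and let $A_\varepsilon(x):=A_1(x/\varepsilon)$. If the mesh size $H$ of the square mesh $\mathcal{Q}_H$ of $\Omega$ is an integer multiple of $\varepsilon$, then the $\mathcal{Q}_H$-piecewise constant numerical coefficient $A_H^\infty$ coincides with the homogenized coefficient $A_0$ of classical periodic homogenization, i.e. $$\bigl[A^\infty_H|_Q\bigr]_{kj}=(A_0)_{kj}\qquad\text{for all } Q\in\mathcal{Q}_H \text{ and } k,j\in\{1,2\}.$$
   Context: **Setting.** $\Omega=[0,1]^2$, $\varepsilon\Omega=[0,\varepsilon]^2$. The coefficient $A_1\in L^\infty(\Omega;\mathbb{R}^{2\times2})$ is symmetric, extended $\Omega$-periodically to $\mathbb{R}^2$, and satisfies $\alpha|\xi|^2\le \xi\cdot A_1(x)\xi\le\beta|\xi|^2$ for all $\xi\in\mathbb{R}^2$ and a.a. $x$, with $0<\alpha\le\beta$. Set $A_\varepsilon(x)=A_1(x/\varepsilon)$. $V:=H^1_\#(\Omega)/\mathbb{R}$ is the space of $\Omega$-periodic $H^1$ functions modulo constants. $(e_1,e_2)$ is the canonical basis of $\mathbb{R}^2$. **Homogenized coefficient.** For $j=1,2$ let $w_j\in V$ be the unique solution of the cell problem $$\int_\Omega A_1(x)(\nabla w_j(x)-e_j)\cdot\nabla v(x)\,dx=0\quad\text{for all }v\in V,$$ and set $$(A_0)_{kj}=\int_\Omega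 \bigl(A_1(x)(e_j-\nabla w_j(x))\bigr)\cdot(e_k-\nabla w_k(x))\,dx .$$ **Meshes.** $\mathcal{Q}_H$ is the uniform partition of $\Omega$ into squares of side length $H$ (so $1/H$ is a positive integer), and $\mathcal{T}_H$ is the structured triangulation obtained by splitting every square of $\mathcal{Q}_H$ into two triangles by a diagonal, with the same diagonal direction in all squares; both have the same set of nodes. Both are understood as periodic partitions (opposite faces of the unit square are identified; equivalently they are continued periodically to $\mathbb{R}^2$). Here $0<\varepsilon\le H$; since $H$ is an integer multiple of $\varepsilon$, $1/\varepsilon$ is an integer and $A_\varepsilon$ is $\Omega$-periodic. **Finite element space and quasi-interpolation.** $\mathcal{P}_1(\mathcal{T}_H)$ is the space of globally continuous, $\Omega$-periodic, $\mathcal{T}_H$-piecewise affine functions, modulo constants. The operator $I_H=E_H\circ\Pi_H:V\to\mathcal{P}_1(\mathcal{T}_H)$ is defined as follows: $\Pi_H v$ is, on each $T\in\mathcal{T}_H$, the $L^2(T)$-orthogonal projection of $v$ onto the affine functions on $T$; and $E_H\Pi_Hv$ is the continuous piecewise affine function whose value at each vertex $z$ is $$\frac{1}{\#\{T\in\mathcal{T}_H: z\in T\}}\sum_{T\in\mathcal{T}_H,\ z\in T}(\Pi_Hv)|_T(z),$$ with the triangulation understood periodically. (These operators preserve constants, so $I_H$ is well defined modulo constants.) Let $W:=\ker I_H\subset V$. **Correctors and numerical coefficient.** For $Q\in\mathcal{Q}_H$ and $j=1,2$ let $q^\infty_{Q,j}\in W$ be the unique solution of $$\int_\Omega A_\varepsilon\nabla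 q^\infty_{Q,j}\cdot\nabla w\,dx=\int_Q A_\varepsilon e_j\cdot\nabla w\,dx\quad\text{for all }w\in W,$$ and define $$\bigl[A^\infty_H|_Q\bigr]_{kj}=\frac1{|Q|}\int_Q A_\varepsilon e_j\cdot e_k\,dx-\frac1{|Q|}\int_\Omega A_\varepsilon\nabla q^\infty_{Q,j}\cdot e_k\,dx .$$ *)

(* Defs.v *)
From HB Require Import structures.
From mathcomp Require Import all_boot all_order all_algebra finmap.
From mathcomp Require Import all_classical all_reals all_analysis.

Set Implicit Arguments.
Unset Strict Implicit.
Unset Printing Implicit Defensive.

Import Order.TTheory GRing.Theory Num.Theory.
Import numFieldNormedType.Exports.

Local Open Scope classical_set_scope.
Local Open Scope ring_scope.

(* The plane is R * R (this carries both the product topology and the product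
   sigma-algebra); vectors and matrices acting on gradients are 'cV[R]_2 and
   'M[R]_2. *)

Notation leb2 R := (@lebesgue_measure R \x @lebesgue_measure R)%E.

Definition Omega (R : realType) : set (R * R) := `[0, 1] `*` `[0, 1].

Definition dot (R : realType) (u v : 'cV[R]_2) : R := \sum_i u i 0 * v i 0.

Definition evec (R : realType) (i : 'I_2) : 'cV[R]_2 := delta_mx i 0.

Definition periodic2 (R : realType) (X : Type) (f : R * R -> X) : Prop :=
  forall x, f (x.1 + 1, x.2) = f x /\ f (x.1, x.2 + 1) = f x.

(** Periodic Sobolev functions *)

Definition dirvec (R : realType) (i : 'I_2) : R * R :=
  if i == ord0 then (1, 0) else (0, 1).

Fixpoint Ck (R : realType) (n : nat) (f : R * R -> R) : Prop :=
  continuous f /\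
  if n is m.+1 then
    (forall x v, derivable f x v) /\ (forall v, Ck m (fun x => 'D_v f x))
  else True.

Definition test_function (R : realType) (phi : R * R -> R) : Prop :=
  (forall n, Ck n phi) /\
  exists2 K : set (R * R), compact K & forall x, ~ K x -> phi x = 0.

Definition weak_gradient (R : realType) (u : R * R -> R)
    (g : R * R -> 'cV[R]_2) : Prop :=
  forall phi, test_function phi -> forall i : 'I_2,
    \int[leb2 R]_x (u x * 'D_(dirvec R i) phi x)
      = - \int[leb2 R]_x (g x i 0 * phi x).

Definition sqr_integrable (R : realType) (u : R * R -> R) : Prop :=
  measurable_fun [set: measurableTypeR R * measurableTypeR R] u /\
  (leb2 R).-integrable (@Omega R) (fun x => (u x ^+ 2)%:E).

(* H^1_#(Omega).  An element is an everywhere periodic representative on the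
   whole plane, bundled with its weak gradient (which u determines almost
   everywhere).  Elements of V = H^1_#(Omega)/R are handled through such
   representatives: the cell and corrector problems see only gradients, and
   the kernel of I_H is taken modulo constants. *)
Record H1per (R : realType) := MkH1per {
  fn : R * R -> R ;
  grad : R * R -> 'cV[R]_2 ;
  fn_periodic : periodic2 fn ;
  grad_periodic : periodic2 grad ;
  fn_L2 : sqr_integrable fn ;
  grad_L2 : forall i, sqr_integrable (fun x => grad x i 0) ;
  grad_weak : weak_gradient fn grad
}.

(** Coefficients *)

Record coefficient (R : realType) (alpha beta : R)
    (A : R * R -> 'M[R]_2) : Prop := MkCoefficient {
  coef_periodic : periodic2 A ;
  coef_measurable : forall i j,
    measurable_fun [set: measurableTypeR R * measurableTypeR R] (fun x => A x i j) ;
  coef_bounded : exists M : R,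
    {ae leb2 R, forall x, Omega x -> forall i j, `|A x i j| <= M} ;
  coef_symmetric : {ae leb2 R, forall x, Omega x -> (A x)^T = A x} ;
  coef_elliptic : {ae leb2 R, forall x, Omega x -> forall xi : 'cV[R]_2,
    alpha * dot xi xi <= dot xi (A x *m xi) <= beta * dot xi xi}
}.

Definition rescale (R : realType) (eps : R) (A : R * R -> 'M[R]_2) :
  R * R -> 'M[R]_2 := fun x => A (x.1 / eps, x.2 / eps).

Definition cell_solution (R : realType) (A : R * R -> 'M[R]_2) (j : 'I_2)
    (w : H1per R) : Prop :=
  forall v : H1per R,
    \int[leb2 R]_(x in @Omega R) dot (A x *m (grad w x - evec R j)) (grad v x)
      = 0.

Definition homogenized (R : realType) (A : R * R -> 'M[R]_2)
    (w : 'I_2 -> H1per R) : 'M[R]_2 :=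
  \matrix_(k, j)
    \int[leb2 R]_(x in @Omega R)
      dot (A x *m (evec R j - grad (w j) x)) (evec R k - grad (w k) x).

(** Meshes, continued periodically to the plane *)

Definition node (R : realType) (H : R) (z : int * int) : R * R :=
  (z.1%:~R * H, z.2%:~R * H).

Definition square (R : realType) (H : R) (z : int * int) : set (R * R) :=
  `[z.1%:~R * H, (z.1 + 1)%:~R * H] `*` `[z.2%:~R * H, (z.2 + 1)%:~R * H].

(* The square z is cut by its south-west/north-east diagonal when d is true, by
   the other one when d is false; the boolean T.2 selects the triangle below
   or above the diagonal. *)
Definition triangle (R : realType) (d : bool) (H : R)
    (T : (int * int) * bool) : set (R * R) :=
  [set x | square H T.1 x /\
    let s := x.1 - (node H T.1).1 in
    let t := x.2 - (node H T.1).2 in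
    let h := if d then s else H - s in
    if T.2 then t <= h else h <= t].

(** Quasi-interpolation *)

Definition affine (R : realType) (p : R * R -> R) : Prop :=
  exists a b c : R, forall x, p x = a + b * x.1 + c * x.2.

Definition L2proj (R : realType) (T : set (R * R)) (v : R * R -> R) :
    R * R -> R :=
  xget (fun=> 0) [set p | affine p /\
    forall r, affine r -> \int[leb2 R]_(x in T) ((v x - p x) * r x) = 0].

(* An affine function on a triangle is identified with its affine extension to
   the plane. *)
Definition PiH (R : realType) (d : bool) (H : R) (v : R * R -> R) :
    (int * int) * bool -> R * R -> R :=
  fun T => L2proj (triangle d H T) v.

Definition P1per (R : realType) (d : bool) (H : R) : set (R * R -> R) :=
  [set f | [/\ continuous f, periodic2 f &
    forall T, exists2 p, affine p & forall x, triangle d H T x -> f x = p x]].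

Definition star (R : realType) (d : bool) (H : R) (z : int * int) :
  set ((int * int) * bool) := [set T | triangle d H T (node H z)].

Definition EH (R : realType) (d : bool) (H : R)
    (p : (int * int) * bool -> R * R -> R) : R * R -> R :=
  xget (fun=> 0) [set f | P1per d H f /\ forall z,
    f (node H z) = (#|` fset_set (star d H z)|)%fset%:R^-1 *
                   \sum_(T \in star d H z) p T (node H z)].

Definition IH (R : realType) (d : bool) (H : R) (v : R * R -> R) : R * R -> R :=
  EH d H (PiH d H v).

(* The kernel of I_H : V -> P_1(T_H), where both spaces are modulo
   constants. *)
Definition kerIH (R : realType) (d : bool) (H : R) : set (H1per R) :=
  [set v | exists c : R, forall x, IH d H (fn v) x = c].

(** Correctors and numerical coefficient *)

Definition corrector (R : realType) (d : bool) (H : R)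
    (Ae : R * R -> 'M[R]_2) (Q : set (R * R)) (j : 'I_2)
    (q : H1per R) : Prop :=
  kerIH d H q /\
  forall w : H1per R, kerIH d H w ->
    \int[leb2 R]_(x in @Omega R) dot (Ae x *m grad q x) (grad w x)
      = \int[leb2 R]_(x in Q) dot (Ae x *m evec R j) (grad w x).

Definition numerical_coef (R : realType) (Ae : R * R -> 'M[R]_2)
    (Q : set (R * R)) (q : 'I_2 -> H1per R) : 'M[R]_2 :=
  \matrix_(k, j)
    ((fine (leb2 R Q))^-1 *
       (\int[leb2 R]_(x in Q) dot (Ae x *m evec R j) (evec R k))
     - (fine (leb2 R Q))^-1 *
       (\int[leb2 R]_(x in @Omega R) dot (Ae x *m grad (q j) x) (evec R k))).

(* Main.v *)
Require Import Defs.
From mathcomp Require Import all_boot all_order all_algebra.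
From mathcomp Require Import all_classical all_reals all_analysis.
From mathcomp Require Import finmap measurable_realfun ring lra.
Import Order.TTheory GRing.Theory Num.Theory.
Import numFieldNormedType.Exports.
Local Open Scope classical_set_scope.
Local Open Scope ring_scope.

Set Implicit Arguments.
Unset Strict Implicit.
Unset Printing Implicit Defensive.

(** Write w_k^eps(x) = eps w_k(x / eps) for the rescaled cell functions.

    Since H is a multiple of eps, w_k^eps has period H in both directions.  Its
    local projections on the mesh are then translates of each other, all its
    nodal averages agree, and its quasi-interpolant is constant
    ([IH_periodic_cst]).  So w_k^eps belongs to W and may be used as a test
    function in the corrector problem of every square Q.

    Conversely, a corrector q = q_(Q,j) can be used in the cell problem after it
    has been folded: p(y) = eps^-1 sum_s q (eps (y + s)), with s in the grid
    {0, ..., 1/eps - 1}^2, has period 1 ([H1per_fold]), its gradient is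
    sum_s grad q (eps (y + s)), and for every periodic field g
      int_Omega A_eps grad q . g (x / eps) = eps^2 int_Omega A_1 grad p . g
    ([fold_form]).  By symmetry of A_1 and the cell problem for w_k tested with
    p, the right-hand side is the same for g = e_k and for g = grad w_k.  Hence
      int_Omega A_eps grad q . e_k = int_Omega A_eps grad q . grad w_k^eps
                                   = int_Q A_eps e_j . grad w_k^eps,
    where the last step is the corrector problem tested with w_k^eps.  Therefore
      [A_H|_Q]_kj = |Q|^-1 int_Q A_eps e_j . (e_k - grad w_k^eps),
    the average of an eps-periodic function over a square made of whole
    eps-cells, which is the average over the unit cell
    ([periodic_integral_box]): int_Omega A_1 e_j . (e_k - grad w_k).  The cell
    problem for w_k tested with w_j allows e_j to be replaced by e_j - grad w_j,
    and the result is (A_0)_kj.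

    All changes of variables come from the tiling formula [integral_tile], which
    combines the scaling of planar Lebesgue measure with the decomposition of a
    square into unit cells.  Weak gradients are carried along a dilation by
    carrying the test functions back ([weak_gradient_int_dilate]).  That the
    projections of an H-periodic function are translates of each other rests on
    the uniqueness of the projection onto affine functions ([L2proj_unique]). *)

(** * Dilations of the plane and Lebesgue measure *)

Notation plane R := (measurableTypeR R * measurableTypeR R)%type.

Definition dilate (R : realType) (l : R) (b x : R * R) : R * R := b + l *: x.

Lemma dilateE (R : realType) (l : R) (b x : R * R) :
  dilate l b x = (b.1 + l * x.1, b.2 + l * x.2).
Proof. by []. Qed.

Lemma measurable_dilate1 (R : realType) (l b : R) :
  measurable_fun [set: measurableTypeR R]
    ((fun x => b + l * x) : measurableTypeR R -> measurableTypeR R).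
Proof. exact: measurable_funD. Qed.

Lemma measurable_dilate (R : realType) (l : R) (b : R * R) :
  measurable_fun [set: plane R] (dilate l b : plane R -> plane R).
Proof.
apply: measurable_fun_pair => /=.
  exact: (measurableT_comp (measurable_dilate1 l b.1)).
exact: (measurableT_comp (measurable_dilate1 l b.2)).
Qed.

(** Both sides are measures in A that agree on half-open intervals, so they agree
    on the generated sigma-algebra. *)
Lemma lebesgue_measure_dilate (R : realType) (l b : R) (A : set (measurableTypeR R)) :
  0 < l -> measurable A ->
  lebesgue_measure A = (l%:E * lebesgue_measure ((fun x => b + l * x)%R @^-1` A))%E.
Proof.
move=> l0 mA; pose k : {nonneg R} := NngNum (ltW l0).
apply: (@lebesgue_measure_unique R (mscale k (pushforward (@lebesgue_measure R)
  ((fun x => b + l * x)%R : measurableTypeR R -> measurableTypeR R)))) => //.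
  exact: measurable_dilate1.
move=> mf _ [[x y]] _ <-.
have E : (fun t => b + l * t) @^-1` `]x, y] = `](x - b) / l, (y - b) / l]%classic.
  apply/seteqP; split=> z /=; rewrite !in_itv /= ltr_pdivrMr// ler_pdivlMr//; lra.
transitivity (l%:E * @lebesgue_measure R `]((x - b) / l)%R, ((y - b) / l)%R]%classic)%E;
  last by rewrite -E.
rewrite !lebesgue_measure_itv/= !lte_fin ltr_pM2r ?invr_gt0// ltrD2r.
case: ifPn => _; last by rewrite mule0.
by rewrite -!EFinB -EFinM; congr EFin; field; lra.
Qed.

(** A product measure is determined by its values on rectangles, where the
    one-dimensional scaling factor l occurs twice. *)
Lemma leb2_dilate (R : realType) (l : R) (b : R * R) (A : set (plane R)) :
  0 < l -> measurable A ->
  (leb2 R) A = ((l ^+ 2)%:E * (leb2 R) (dilate l b @^-1` A))%E.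
Proof.
move=> l0 mA; have l20 : 0 <= l ^+ 2 by rewrite exprn_ge0// ltW.
pose k : {nonneg R} := NngNum l20.
apply: (@product_measure_unique _ _ _ _ _ lebesgue_measure lebesgue_measure
  (mscale k (pushforward (leb2 R) (dilate l b : plane R -> plane R)))) => //.
  exact: measurable_dilate.
move=> mf B C mB mC.
transitivity ((l ^+ 2)%:E * (leb2 R)
   (((fun x => b.1 + l * x)%R @^-1` B) `*` ((fun x => b.2 + l * x)%R @^-1` C)))%E.
  by [].
rewrite product_measure1E//; last 2 first.
- by rewrite -[X in measurable X]setTI; exact: measurable_dilate1.
- by rewrite -[X in measurable X]setTI; exact: measurable_dilate1.
rewrite expr2 EFinM muleACA.
by congr (_ * _)%E; apply/esym/lebesgue_measure_dilate.
Qed.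

Lemma ge0_integral_dilate (R : realType) (l : R) (b : R * R) (D : set (plane R))
    (f : plane R -> \bar R) : 0 < l -> measurable D ->
  measurable_fun D f -> (forall x, D x -> 0 <= f x)%E ->
  (\int[leb2 R]_(x in D) f x =
   (l ^+ 2)%:E * \int[leb2 R]_(x in dilate l b @^-1` D) f (dilate l b x))%E.
Proof.
move=> l0 mD mf f0; have l20 : 0 <= l ^+ 2 by rewrite exprn_ge0// ltW.
pose k : {nonneg R} := NngNum l20.
have mph := measurable_dilate l b.
rewrite -(ge0_integral_pushforward mph)//; last by move=> x /set_mem; exact: f0.
rewrite -(@ge0_integral_mscale _ _ _ _ _ mD k f)//.
apply: eq_measure_integral => //= A mA _.
by rewrite /mscale /pushforward/= (leb2_dilate b l0 mA).
Qed.

(** The positive and negative parts scale separately, and a positive real factor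
    distributes over their difference even when both are infinite; hence the
    identity holds in the extended reals for every measurable f. *)
Lemma integral_dilate (R : realType) (l : R) (b : R * R) (D : set (plane R))
    (f : plane R -> \bar R) : 0 < l -> measurable D ->
  measurable_fun D f ->
  (\int[leb2 R]_(x in D) f x =
   (l ^+ 2)%:E * \int[leb2 R]_(x in dilate l b @^-1` D) f (dilate l b x))%E.
Proof.
move=> l0 mD mf; rewrite integralE [in RHS]integralE.
rewrite (ge0_integral_dilate b l0 mD (measurable_funepos mf))//.
rewrite (ge0_integral_dilate b l0 mD (measurable_funeneg mf))//.
have muleB (c : R) (x y : \bar R) : 0 < c -> (0 <= x -> 0 <= y ->
    c%:E * x - c%:E * y = c%:E * (x - y))%E.
  move=> c0; case: x => [x| |]//; case: y => [y| |]// x0 y0.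
  - by rewrite muleBr.
  - by rewrite muleBr.
  - by rewrite gt0_muley ?lte_fin// addye// gt0_muley ?lte_fin.
  - by rewrite gt0_muley ?lte_fin// addeNy gt0_muleNy ?lte_fin.
have p0 : (0 <= \int[leb2 R]_(x in dilate l b @^-1` D) f^\+ (dilate l b x))%E.
  by apply: integral_ge0.
have n0 : (0 <= \int[leb2 R]_(x in dilate l b @^-1` D) f^\- (dilate l b x))%E.
  by apply: integral_ge0.
rewrite (muleB _ _ _ (exprn_gt0 2 l0) p0 n0).
congr (_ * (_ - _))%E; apply: eq_integral => x _.
  by rewrite !unlock.
by rewrite !unlock.
Qed.

(** * Cutting a square into translates of the unit cell *)

Lemma leb2X (R : realType) (A B : set (measurableTypeR R)) :
  measurable A -> measurable B ->
  (leb2 R) (A `*` B) = (lebesgue_measure A * lebesgue_measure B)%E.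
Proof. by move=> mA mB; rewrite product_measure1E. Qed.

Definition box (R : realType) (b : R * R) (l : R) : set (R * R) :=
  `[b.1, b.1 + l] `*` `[b.2, b.2 + l].

(** Half-open, so that a square of integer side is a disjoint union of unit cells. *)
Definition obox (R : realType) (b : R * R) (l : R) : set (R * R) :=
  `[b.1, b.1 + l[ `*` `[b.2, b.2 + l[.

Lemma OmegaE (R : realType) : @Omega R = box 0 1.
Proof. by rewrite /box/= add0r. Qed.

Lemma measurable_box (R : realType) (b : R * R) l :
  measurable (box b l : set (plane R)).
Proof. exact: measurableX. Qed.

Lemma measurable_obox (R : realType) (b : R * R) l :
  measurable (obox b l : set (plane R)).
Proof. exact: measurableX. Qed.

Lemma leb2_box (R : realType) (b : R * R) l : 0 <= l ->
  (leb2 R) (box b l) = (l ^+ 2)%:E.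
Proof.
move=> l0; rewrite leb2X// !lebesgue_measure_itv/= !lte_fin.
rewrite !ltrDl; case: ltgtP l0 => // [l0|<-] _; last by rewrite expr0n mule0.
rewrite -!EFinB -EFinM; congr EFin; ring.
Qed.

(** The two missing edges lie on lines, which are null sets of the plane. *)
Lemma integral_box_obox (R : realType) (b : R * R) l (f : plane R -> \bar R) :
  measurable_fun setT f ->
  (\int[leb2 R]_(x in box b l) f x = \int[leb2 R]_(x in obox b l) f x)%E.
Proof.
move=> mf.
have mb := measurable_box b l; have mo := measurable_obox b l.
have oU : box b l = obox b l `|` (box b l `\` obox b l).
  apply/seteqP; split=> x.
    by move=> bx; have [|] := pselect (obox b l x); [left|right].
  case=> [|[]]//; rewrite /obox /box/= !in_itv/=.
  by move=> [/andP[-> /ltW ->] /andP[-> /ltW ->]].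
rewrite [X in (\int[_]_(x in X) _)%E = _]oU integral_setU; last 4 first.
- by [].
- exact: measurableD.
- exact: measurable_funTS.
- by apply/disj_setPS => x [? []].
rewrite [X in (_ + X)%E]null_set_integral ?adde0//.
- exact: measurableD.
- exact: measurable_funTS.
apply/eqP; rewrite -measure_le0.
apply: (@le_trans _ _ ((leb2 R) (([set b.1 + l] `*` setT) `|` (setT `*` [set b.2 + l])))).
  apply: le_measure.
  - by apply/mem_set; exact: measurableD.
  - by apply/mem_set; apply: measurableU; exact: measurableX.
  move=> x [] []/=; rewrite !in_itv/= => /andP[x1 x2] /andP[x3 x4] nx.
  have [h1|h1] := ltP x.1 (b.1 + l); last first.
    by left; split => //=; apply/eqP; rewrite eq_le x2.
  have [h2|h2] := ltP x.2 (b.2 + l); last first.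
    by right; split => //=; apply/eqP; rewrite eq_le x4.
  by exfalso; apply: nx; rewrite /obox/= !in_itv/= x1 x3 h1 h2.
have mX1 : measurable (([set b.1 + l] `*` setT) : set (plane R)) by exact: measurableX.
have mX2 : measurable ((setT `*` [set b.2 + l]) : set (plane R)) by exact: measurableX.
have z1 : ((leb2 R) ([set (b.1 + l)%R] `*` setT) <= 0)%E.
  by rewrite leb2X// lebesgue_measure_set1 mul0e.
have z2 : ((leb2 R) (setT `*` [set (b.2 + l)%R]) <= 0)%E.
  by rewrite leb2X// lebesgue_measure_set1 mule0.
rewrite -[leRHS](adde0 0%E).
exact: (le_trans (measureU2 _ mX1 mX2) (leeD z1 z2)).
Qed.

(** The cell of a point is read off from the integer parts of its coordinates. *)
Lemma obox_tile (R : realType) n :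
  obox (0 : R * R) n%:R =
  \big[setU/set0]_(s <- enum {: 'I_n * 'I_n}) obox (s.1%:R, s.2%:R) 1.
Proof.
rewrite -bigcup_seq; apply/seteqP; split=> x; rewrite /obox/= !in_itv/= ?add0r.
  move=> [/andP[x1 x1n] /andP[x2 x2n]].
  have /andP[t1 t1'] := Num.Theory.truncn_itv x1.
  have /andP[t2 t2'] := Num.Theory.truncn_itv x2.
  have s1 : (Num.truncn x.1 < n)%N by rewrite -(ltr_nat R) (le_lt_trans t1).
  have s2 : (Num.truncn x.2 < n)%N by rewrite -(ltr_nat R) (le_lt_trans t2).
  exists (Ordinal s1, Ordinal s2); first by rewrite /= mem_enum.
  by rewrite /= !in_itv/= t1 t2 !natr1 t1' t2'.
move=> [[s1 s2] _ /=]; rewrite !in_itv/= => -[/andP[x1 x1n] /andP[x2 x2n]].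
rewrite (le_trans _ x1)// (le_trans _ x2)//=.
by rewrite (lt_le_trans x1n) ?(lt_le_trans x2n)// natr1 ler_nat ltn_ord.
Qed.

Lemma trivIset_tile (R : realType) n (D : set ('I_n * 'I_n)) :
  trivIset D (fun s : 'I_n * 'I_n => obox (s.1%:R : R, s.2%:R : R) 1).
Proof.
apply/trivIsetP => -[i1 i2] [j1 j2] _ _ ij; apply/seteqP; split => // x.
rewrite /obox/= !in_itv/= => -[[/andP[a1 a2] /andP[a3 a4]] [/andP[b1 b2] /andP[b3 b4]]].
have aux (a b : nat) (y : R) : a%:R <= y -> y < b%:R + 1 -> (a <= b)%N.
  by move=> ay yb; rewrite -ltnS -(ltr_nat R) -natr1 (le_lt_trans ay).
move/eqP: ij; apply; congr pair; apply/val_inj/eqP; rewrite eqn_leq.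
  by rewrite (aux _ _ _ a1 b2) (aux _ _ _ b1 a2).
by rewrite (aux _ _ _ a3 b4) (aux _ _ _ b3 a4).
Qed.

Definition grid_pt (R : realType) n (s : 'I_n * 'I_n) : R * R := (s.1%:R, s.2%:R).

(** The tool behind every change of variables below: a square of side l n is the
    image under [dilate l b] of n x n unit cells, and each cell is a translate of
    the first.  Closed cells may be used on the right because edges are null. *)
Lemma integral_tile (R : realType) n (l : R) (b : R * R) (f : plane R -> R) :
  0 < l -> measurable_fun setT f ->
  (\int[leb2 R]_(x in box b (l * n%:R)) (f x)%:E =
   (l ^+ 2)%:E * \sum_(s : 'I_n * 'I_n)
     \int[leb2 R]_(x in @Omega R) (f (dilate l (dilate l b (grid_pt R s)) x))%:E)%E.
Proof.
move=> l0 mf.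
have mfE : measurable_fun setT (EFin \o f) by exact/measurable_EFinP.
rewrite integral_box_obox// (integral_dilate b l0)//; last 2 first.
- exact: measurable_obox.
- exact: measurable_funTS.
have -> : dilate l b @^-1` obox b (l * n%:R) = obox 0 n%:R.
  apply/seteqP; split=> x; rewrite /obox/= !in_itv/= !add0r !lerDl !ltrD2l;
    by rewrite !pmulr_rge0// !ltr_pM2l.
rewrite obox_tile integral_bigsetU_EFin//; last 4 first.
- by move=> s; exact: measurable_obox.
- exact: enum_uniq.
- exact: trivIset_tile.
- apply: measurable_funTS; apply: measurableT_comp => //.
  by apply: measurableT_comp => //; exact: measurable_dilate.
rewrite big_enum/=; congr (_ * _)%E; apply: eq_bigr => s _.
have mg : measurable_fun setT (EFin \o (f \o dilate l b)).
  by apply: measurableT_comp => //; apply: measurableT_comp => //; exact: measurable_dilate.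
rewrite (integral_dilate (grid_pt R s) ltr01)//; last 2 first.
- exact: measurable_obox.
- exact: measurable_funTS.
rewrite expr1n mul1e OmegaE.
rewrite [RHS]integral_box_obox; last first.
  by apply: measurableT_comp => //; apply: measurableT_comp => //; exact: measurable_dilate.
have -> : dilate 1 (grid_pt R s) @^-1` obox (s.1%:R, s.2%:R) 1 = obox (0 : R * R) 1.
  apply/seteqP; split=> x; rewrite /preimage/= dilateE /obox/= !in_itv/= !mul1r;
    by rewrite !add0r !lerDl !ltrD2l.
apply: eq_integral => x _; congr (f _)%:E.
by rewrite /dilate scale1r scalerDr addrA.
Qed.

(** * Square-integrable functions on the unit cell *)

Lemma measurable_comp_dilate (R : realType) (f : plane R -> R) l b :
  measurable_fun setT f ->
  measurable_fun [set: plane R] (fun x : plane R => f (dilate l b x)).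
Proof. by move=> mf; apply: measurableT_comp => //; exact: measurable_dilate. Qed.

Lemma measurable_dilate_preimage (R : realType) (l : R) (b : R * R) (D : set (plane R)) :
  measurable D -> measurable (dilate l b @^-1` D : set (plane R)).
Proof. by move=> mD; rewrite -[X in measurable X]setTI; exact: measurable_dilate. Qed.

Lemma measurable_Omega (R : realType) : measurable (@Omega R : set (plane R)).
Proof. by rewrite OmegaE; exact: measurable_box. Qed.
#[local] Hint Resolve measurable_Omega : core.

(** Apply the tiling formula to the absolute value. *)
Lemma integrable_tile (R : realType) n (l : R) (b : R * R) (f : plane R -> R) :
  0 < l -> measurable_fun setT f ->
  (forall s : 'I_n * 'I_n, (leb2 R).-integrable (@Omega R)
     (fun x => (f (dilate l (dilate l b (grid_pt R s)) x))%:E)) ->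
  (leb2 R).-integrable (box b (l * n%:R)) (fun x => (f x)%:E).
Proof.
move=> l0 mf intf.
have mnf : measurable_fun setT (fun x => `|f x|) by exact: measurableT_comp.
apply/integrableP; split.
  by apply: measurable_funTS; exact/measurable_EFinP.
rewrite [ltLHS](integral_tile n b l0 mnf).
rewrite lte_mul_pinfty// ?lee_fin ?exprn_ge0 ?ltW//.
by rewrite lte_sum_pinfty// => s _; have /integrableP[_] := intf s.
Qed.

Lemma Rintegral_tile (R : realType) n (l : R) (b : R * R) (f : plane R -> R) :
  0 < l -> measurable_fun setT f ->
  (forall s : 'I_n * 'I_n, (leb2 R).-integrable (@Omega R)
     (fun x => (f (dilate l (dilate l b (grid_pt R s)) x))%:E)) ->
  \int[leb2 R]_(x in box b (l * n%:R)) f x =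
  l ^+ 2 * \sum_(s : 'I_n * 'I_n)
    \int[leb2 R]_(x in @Omega R) f (dilate l (dilate l b (grid_pt R s)) x).
Proof.
move=> l0 mf intf; rewrite {1}/Rintegral integral_tile//.
rewrite fineM//; last by apply/sum_fin_numP => s _ _; exact: integrable_fin_num.
by rewrite -sum_fine// => s _; exact: integrable_fin_num.
Qed.

Lemma integrable_dilate (R : realType) (l : R) (b : R * R) (D : set (plane R))
    (f : plane R -> R) :
  0 < l -> measurable D -> measurable_fun setT f ->
  (leb2 R).-integrable D (fun x => (f x)%:E) <->
  (leb2 R).-integrable (dilate l b @^-1` D) (fun x => (f (dilate l b x))%:E).
Proof.
move=> l0 mD mf; have l20 : 0 < l ^+ 2 by rewrite exprn_gt0.
have mEf : measurable_fun setT (fun x => `|f x|%:E).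
  by apply/measurable_EFinP; exact: measurableT_comp.
have E := ge0_integral_dilate b l0 mD (measurable_funTS mEf)
            (fun x _ => normr_ge0 (f x) : (0 <= `|f x|%:E)%E).
split=> /integrableP[_ h]; apply/integrableP; split.
- apply: measurable_funTS; apply/measurable_EFinP.
  exact: measurable_comp_dilate.
- move: h; rewrite /= E; set I := integral _ _ _.
  have : (0 <= I)%E by exact: integral_ge0.
  by case: I => [r _ _| |]//; [rewrite ltry|rewrite gt0_muley ?lte_fin].
- by apply: measurable_funTS; apply/measurable_EFinP.
- by rewrite /= E lte_mul_pinfty ?lee_fin// ltW.
Qed.

Lemma Rintegral_dilate (R : realType) (l : R) (b : R * R) (D : set (plane R))
    (f : plane R -> R) :
  0 < l -> measurable D -> measurable_fun setT f ->
  (leb2 R).-integrable D (fun x => (f x)%:E) ->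
  \int[leb2 R]_(x in D) f x =
  l ^+ 2 * \int[leb2 R]_(x in dilate l b @^-1` D) f (dilate l b x).
Proof.
move=> l0 mD mf intf; rewrite /Rintegral (integral_dilate b l0)//; last first.
  by apply: measurable_funTS; apply/measurable_EFinP.
rewrite fineM//; apply: integrable_fin_num.
  exact: measurable_dilate_preimage.
exact: (proj1 (integrable_dilate b l0 mD mf) intf).
Qed.

Lemma dilate_preimage_box (R : realType) (l : R) (b : R * R) :
  0 < l -> dilate l b @^-1` box b l = @Omega R.
Proof.
move=> l0; rewrite OmegaE; apply/seteqP; split=> x;
  rewrite /box /preimage/= !in_itv/= !add0r !lerDl !lerD2l;
  by rewrite !pmulr_rge0// !ger_pMr.
Qed.

Lemma leb2_Omega (R : realType) : (leb2 R) (@Omega R) = 1%:E.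
Proof. by rewrite OmegaE leb2_box// expr1n. Qed.

(** |u v| <= u^2 + v^2 pointwise. *)
Lemma sqr_integrable_mul (R : realType) (u v : R * R -> R) :
  sqr_integrable u -> sqr_integrable v ->
  (leb2 R).-integrable (@Omega R) (fun x => (u x * v x)%:E).
Proof.
move=> [mu iu] [mv iv].
have muv : measurable_fun setT (fun x : plane R => u x * v x) by exact: measurable_funM.
apply: (@le_integrable _ _ _ (leb2 R) _ _ _ (fun x => (u x ^+ 2)%:E + (v x ^+ 2)%:E)%E).
- exact: measurable_Omega.
- by apply: measurable_funTS; apply/measurable_EFinP.
- move=> x _; rewrite -EFinD !abse_EFin lee_fin ler_norml.
  rewrite (ger0_norm (addr_ge0 (sqr_ge0 _) (sqr_ge0 _))).
  by apply/andP; split; nra.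
- exact: integrableD.
Qed.

Lemma sqr_integrable_cst (R : realType) (c : R) : sqr_integrable (fun=> c).
Proof.
split; first exact: measurable_cst.
apply/integrableP; split; first by apply/measurable_EFinP/measurable_cst.
rewrite integral_cst; last exact: measurable_Omega.
by rewrite [X in (_ * X < _)%E]leb2_Omega mule1 ltry.
Qed.

Lemma sqr_integrableZ (R : realType) (c : R) (u : R * R -> R) :
  sqr_integrable u -> sqr_integrable (fun x => c * u x).
Proof.
move=> [mu iu]; split; first by apply: measurable_funM.
rewrite (_ : (fun _ => _) = (fun x => (c ^+ 2)%:E * (u x ^+ 2)%:E)%E).
  by apply: integrableZl => //; exact: measurable_Omega.
by apply/funext => x; rewrite exprMn.
Qed.

Lemma sqr_integrableD (R : realType) (u v : R * R -> R) :
  sqr_integrable u -> sqr_integrable v -> sqr_integrable (fun x => u x + v x).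
Proof.
move=> hu hv; have [mu iu] := hu; have [mv iv] := hv.
split; first exact: measurable_funD.
rewrite (_ : (fun _ => _) = (fun x => (u x ^+ 2)%:E + (v x ^+ 2)%:E
    + 2%:E * (u x * v x)%:E)%E); last first.
  by apply/funext => x; rewrite -EFinM -!EFinD; congr EFin; ring.
have mO := @measurable_Omega R.
apply: integrableD => //; first exact: integrableD.
by apply: integrableZl => //; exact: sqr_integrable_mul.
Qed.

Lemma sqr_integrable_sum (R : realType) (I : Type) (s : seq I)
    (u : I -> R * R -> R) :
  (forall i, sqr_integrable (u i)) -> sqr_integrable (fun x => \sum_(i <- s) u i x).
Proof.
move=> hu; elim: s => [|i s IH].
  under eq_fun do rewrite big_nil; exact: sqr_integrable_cst.
by under eq_fun do rewrite big_cons; exact: sqr_integrableD.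
Qed.

Lemma sqr_integrableB (R : realType) (u v : R * R -> R) :
  sqr_integrable u -> sqr_integrable v -> sqr_integrable (fun x => u x - v x).
Proof.
move=> hu hv; under eq_fun do rewrite -mulN1r.
by apply: sqr_integrableD => //; exact: sqr_integrableZ.
Qed.

Lemma sqr_integrable_integrable (R : realType) (u : R * R -> R) :
  sqr_integrable u -> (leb2 R).-integrable (@Omega R) (fun x => (u x)%:E).
Proof.
move=> hu; under eq_fun do rewrite -[u _]mulr1.
by apply: sqr_integrable_mul => //; exact: sqr_integrable_cst.
Qed.

(** Separates the roles in an energy density: the coefficient is only bounded
    almost everywhere, the products of gradients are integrable. *)
Lemma integrable_aebounded_mul (R : realType) (M : R) (a g : R * R -> R) :
  measurable_fun [set: plane R] a ->
  {ae leb2 R, forall x, Omega x -> `|a x| <= M} ->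
  measurable_fun [set: plane R] g ->
  (leb2 R).-integrable (@Omega R) (fun x => (g x)%:E) ->
  (leb2 R).-integrable (@Omega R) (fun x => (a x * g x)%:E).
Proof.
move=> ma aM mg ig; have mO := @measurable_Omega R.
have mag : measurable_fun setT (fun x : plane R => a x * g x) by exact: measurable_funM.
apply/integrableP; split; first by apply: measurable_funTS; apply/measurable_EFinP.
have /integrableP[_] := integrableZl mO (`|M|) ig.
apply: le_lt_trans; apply: ae_ge0_le_integral => //.
- by apply: measurable_funTS; apply: measurableT_comp => //; apply/measurable_EFinP.
- apply: measurable_funTS; apply: measurableT_comp => //.
  by apply: measurable_funeM; apply/measurable_EFinP.
- apply: negligibleS aM => x /= + {}aM; apply=> Ox; rewrite /= lee_fin !normrM normr_id.
  by rewrite ler_wpM2r// (le_trans (aM Ox))// ler_norm.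
Qed.

(** * Continuous functions and test functions on the plane *)

(** The sigma-algebra of the plane is the one generated by rectangles, and an open
    set is a countable union of open squares with rational centres and radii
    1/(n+1). *)
Lemma continuous_measurable2 (R : realType) (f : R * R -> R) :
  continuous f -> measurable_fun [set: plane R] f.
Proof.
move=> cf; apply: (measurability _ (RGenOInfty.measurableE R)) => //.
move=> /= _ [_ [a ->] <-]; rewrite setTI.
have oU : open (f @^-1` `]a, +oo[).
  by apply: open_comp => // x _; exact: cf.
set U := f @^-1` _ in oU *.
pose B n (p q : rat) : set (R * R) :=
  `](ratr p - n.+1%:R^-1), (ratr p + n.+1%:R^-1)[ `*`
  `](ratr q - n.+1%:R^-1), (ratr q + n.+1%:R^-1)[.
have -> : U = \bigcup_n \bigcup_p \bigcup_q
    (if `[< B n p q `<=` U >] then B n p q else set0).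
  apply/seteqP; split=> [x Ux|x [n _ [p _ [q _]]]]; last by case: asboolP => // + ?; exact.
  move: oU => /(_ _ Ux); rewrite -nbhs_ballE => -[e /= e0 xeU].
  have [n ne] : exists n, n.+1%:R^-1 < e / 2.
    exists (Num.truncn (2 / e)).
    by rewrite invf_plt ?posrE ?divr_gt0// invf_div truncnS_gt.
  have n0 : 0 < n.+1%:R^-1 :> R by rewrite invr_gt0.
  move: ne n0; set r : R := n.+1%:R^-1 => ne n0.
  have near_rat (y : R) : exists p : rat, `|y - ratr p| < r.
    have : y - r < y + r by lra.
    move=> /rat_in_itvoo[p]; rewrite in_itv/= => /andP[h1 h2]; exists p.
    by rewrite ltr_norml; apply/andP; split; lra.
  have [p /[!ltr_norml]/andP[p1 p2]] := near_rat x.1.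
  have [q /[!ltr_norml]/andP[q1 q2]] := near_rat x.2.
  exists n => //; exists p => //; exists q => //; case: asboolP => [_|].
    by rewrite /B/= !in_itv/= -/r; split; apply/andP; split; lra.
  case; move=> y; rewrite /B/= !in_itv/= -/r => -[/andP[a1 a2] /andP[b1 b2]].
  by apply: xeU; split; rewrite /ball/= ltr_norml; apply/andP; split; lra.
apply: bigcupT_measurable => n; apply: bigcupT_measurable_rat => p.
apply: bigcupT_measurable_rat => q; case: ifPn => // _; exact: measurableX.
Qed.

Lemma dilate_shift (R : realType) (l : R) (b : R * R) (h : R) (v x : R * R) :
  dilate l b (h *: v + x) = h *: (l *: v) + dilate l b x.
Proof. by rewrite /dilate scalerDr addrCA !scalerA mulrC. Qed.

(** The two difference quotients are literally the same function. *)
Lemma derive_dilate (R : realType) (l : R) b (f : R * R -> R) v x :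
  'D_v (f \o dilate l b) x = 'D_(l *: v) f (dilate l b x).
Proof.
rewrite /derive; set F := fun h => _; set G := fun h => _.
suff -> : F = G by [].
by apply/funext => h; rewrite /F /G /= dilate_shift.
Qed.

Lemma derivable_dilate (R : realType) (l : R) b (f : R * R -> R) v x :
  derivable f (dilate l b x) (l *: v) -> derivable (f \o dilate l b) x v.
Proof.
rewrite /derivable; set F := fun h => _; set G := fun h => _.
suff -> : F = G by [].
by apply/funext => h; rewrite /F /G /= dilate_shift.
Qed.

(** Along a line through x the function is one-dimensional, and the chain rule
    for h |-> h l applies. *)
Lemma derive_scale (R : realType) (l : R) (f : R * R -> R) v x :
  derivable f x v -> 'D_(l *: v) f x = l * 'D_v f x.
Proof.
have dE (u : R * R) : 'D_u f x = derive1 (fun h : R => f (h *: u + x)) 0.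
  rewrite derive1E /derive; set F := fun h => _; set G := fun h => _.
  suff -> : F = G by [].
  by apply/funext => h; rewrite /F /G /= scale0r add0r addr0 [h *: 1]mulr1.
move=> /derivable1P df; rewrite !dE.
have -> : (fun h : R => f (h *: (l *: v) + x)) =
    (fun h : R => f (h *: v + x)) \o (fun h => h * l).
  by apply/funext => h /=; rewrite scalerA.
rewrite derive1_comp//; last by rewrite mul0r.
by rewrite mul0r derive1Mr// derive1_id mul1r mulrC.
Qed.

Lemma continuous_dilate (R : realType) (l : R) b : continuous (@dilate R l b).
Proof.
move=> x; apply: cvgD; first exact: cvg_cst.
by apply: cvgZr; exact: cvg_id.
Qed.

(** The directional derivative of a dilate is the dilate of a directional
    derivative, so the induction on the order never leaves this form. *)
Lemma Ck_dilate (R : realType) (l : R) b n (f : R * R -> R) :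
  Ck n f -> Ck n (f \o dilate l b).
Proof.
elim: n f => [|n IH] f /= [cf].
  by move=> _; split => // x; apply: continuous_comp; [exact: continuous_dilate|exact: cf].
move=> [df Df]; split.
  by move=> x; apply: continuous_comp; [exact: continuous_dilate|exact: cf].
split=> [x v|v]; first exact: derivable_dilate.
rewrite (_ : (fun x => _) = (fun x => 'D_(l *: v) f x) \o dilate l b); last first.
  by apply/funext => x; rewrite derive_dilate.
exact/IH/Df.
Qed.

Definition dilate_inv (R : realType) (l : R) (b : R * R) : R * R -> R * R :=
  dilate l^-1 (- (l^-1 *: b)).

Lemma dilateK (R : realType) (l : R) (b : R * R) : l != 0 ->
  cancel (dilate l b) (dilate_inv l b).
Proof.
move=> l0 x; rewrite /dilate_inv /dilate scalerDr scalerA mulVf// scale1r addrA.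
by rewrite addNr add0r.
Qed.

Lemma dilate_invK (R : realType) (l : R) (b : R * R) : l != 0 ->
  cancel (dilate_inv l b) (dilate l b).
Proof.
move=> l0 x; rewrite /dilate_inv /dilate scalerDr scalerN !scalerA mulfV// !scale1r addrA.
by rewrite subrr add0r.
Qed.

(** The support is the image of a compact set under the inverse dilation. *)
Lemma test_function_dilate (R : realType) (l : R) b (f : R * R -> R) :
  l != 0 -> test_function f -> test_function (f \o dilate l b).
Proof.
move=> l0 [Cf [K cK K0]]; split=> [n|]; first exact: Ck_dilate.
exists (dilate_inv l b @` K).
  apply: continuous_compact => //; apply: continuous_subspaceT.
  exact: continuous_dilate.
move=> x Kx /=; apply: K0 => Kax; apply: Kx; exists (dilate l b x) => //.
exact: dilateK.
Qed.

(** * Weak gradients of periodic functions and their transport *)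

Lemma periodic_shift (R : realType) (X : Type) (f : R * R -> X) (z1 z2 : int) x :
  periodic2 f -> f (x.1 + z1%:~R, x.2 + z2%:~R) = f x.
Proof.
move=> pf.
have p1 (n : nat) a b : f (a + n%:R, b) = f (a, b).
  elim: n => [|n IH]; first by rewrite addr0.
  by rewrite -natr1 addrA -[RHS]IH; have [/= -> _] := pf (a + n%:R, b).
have p2 (n : nat) a b : f (a, b + n%:R) = f (a, b).
  elim: n => [|n IH]; first by rewrite addr0.
  by rewrite -natr1 addrA -[RHS]IH; have [/= _ ->] := pf (a, b + n%:R).
have q1 (z : int) a b : f (a + z%:~R, b) = f (a, b).
  case: z => n; first exact: p1.
  by rewrite NegzE mulrNz -(p1 n.+1) subrK.
have q2 (z : int) a b : f (a, b + z%:~R) = f (a, b).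
  case: z => n; first exact: p2.
  by rewrite NegzE mulrNz -(p2 n.+1) subrK.
by rewrite q1 q2; case: x.
Qed.

(** The derivatives vanish outside the same square because the complement of the
    compact support is open. *)
Lemma test_support (R : realType) (f : R * R -> R) : test_function f ->
  exists n : nat, forall x, ~ box (- n%:R, - n%:R) (n + n)%:R x ->
    f x = 0 /\ forall v, 'D_v f x = 0.
Proof.
move=> [_ [K cK K0]].
have [M [_ hM]] := compact_bounded cK.
pose n := (Num.truncn (Num.max M 0 + 1)).+1.
have Mn : Num.max M 0 + 1 < n%:R by rewrite /n truncnS_gt.
have M1 : M <= Num.max M 0 by rewrite le_max lexx.
exists n => x nbx.
have nKx : ~ K x.
  move=> Kx; apply: nbx; have := hM (n%:R) _ _ Kx.
  have -> // : M < n%:R by lra.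
  move=> /(_ isT); rewrite /= prod_normE ge_max !ler_norml.
  move=> /andP[/andP[a1 a2] /andP[a3 a4]].
  by rewrite /box/= !in_itv/= natrD; split; apply/andP; split; lra.
split; first exact: K0.
move=> v; have -> : 'D_v f x = 'D_v (cst 0) x; last by rewrite derive_cst.
apply: near_eq_derive.
have cl : closed K by apply: compact_closed => //; exact: norm_hausdorff.
have : nbhs x (~` K) by apply: open_nbhs_nbhs; split => //; exact: closed_openC.
by apply: filterS => y; exact: K0.
Qed.

Lemma bounded_vanishing (R : realType) (b : R * R) l (psi : R * R -> R) :
  continuous psi -> (forall x, ~ box b l x -> psi x = 0) ->
  exists M, forall x, `|psi x| <= M.
Proof.
move=> cpsi psi0.
have cb : compact (box b l) by apply: compact_setX; exact: segment_compact.
have : compact (psi @` box b l).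
  by apply: continuous_compact => //; exact: continuous_subspaceT.
move=> /compact_bounded[M [_ hM]]; exists (`|M| + 1) => x.
have [bx|nbx] := pselect (box b l x).
  apply: hM; last by exists x.
  by apply: (le_lt_trans (ler_norm M)); rewrite ltrDl.
by rewrite psi0// normr0 addr_ge0.
Qed.

(** On a square with integer corners that contains the support, tiling reduces
    integrability to the unit cell, where u is integrable and psi is bounded. *)
Lemma periodic_mul_integrable (R : realType) n (u psi : R * R -> R) :
  periodic2 u -> sqr_integrable u -> continuous psi ->
  (forall x, ~ box (- n%:R, - n%:R) (n + n)%:R x -> psi x = 0) ->
  (leb2 R).-integrable setT (fun x => (u x * psi x)%:E).
Proof.
move=> pu hu cpsi psi0; have [mu _] := hu.
have [M hM] := bounded_vanishing cpsi psi0.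
have mpsi := continuous_measurable2 cpsi.
have mf : measurable_fun setT (fun x : plane R => u x * psi x).
  exact: measurable_funM.
have : (leb2 R).-integrable (box (- n%:R, - n%:R) (1 * (n + n)%:R))
    (fun x => (u x * psi x)%:E).
  apply: integrable_tile => // s.
  have uE x : u (dilate 1 (dilate 1 (- n%:R, - n%:R) (grid_pt R s)) x) = u x.
    rewrite -[RHS](periodic_shift (Posz s.1 - Posz n) (Posz s.2 - Posz n) x pu).
    congr u; rewrite dilateE/= !mul1r !rmorphB/= -!pmulrn.
    by rewrite !scale1r; congr pair; ring.
  under eq_fun do rewrite uE mulrC.
  apply: (@integrable_aebounded_mul _ M) => //.
  - exact: measurable_comp_dilate.
  - by apply: aeW => x _.
  - exact: sqr_integrable_integrable.
rewrite mul1r => /(integrable_mkcond _ (measurable_box _ _)).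
apply: eq_integrable => // x _; rewrite patchE; case: ifPn => // /negP nbx.
by rewrite psi0 ?mulr0// => bx; apply: nbx; exact: mem_set.
Qed.

(** A weak gradient together with the integrability of both sides.  As the
    integral of a non-integrable function is a default value, integrability is
    what makes the notion stable under sums and changes of variables, also for
    functions such as x |-> q (eps x) that do not have period 1. *)
Definition weak_gradient_int (R : realType) (u : R * R -> R)
    (g : R * R -> 'cV[R]_2) : Prop :=
  forall phi, test_function phi -> forall i : 'I_2,
    [/\ (leb2 R).-integrable setT (fun x => (u x * 'D_(dirvec R i) phi x)%:E),
        (leb2 R).-integrable setT (fun x => (g x i 0 * phi x)%:E) &
    \int[leb2 R]_x (u x * 'D_(dirvec R i) phi x)
      = - \int[leb2 R]_x (g x i 0 * phi x)].

Lemma test_continuous (R : realType) (phi : R * R -> R) :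
  test_function phi -> continuous phi.
Proof. by move=> [C _]; have [c _] := C 0%N; exact: c. Qed.

Lemma test_derivable (R : realType) (phi : R * R -> R) x v :
  test_function phi -> derivable phi x v.
Proof. by move=> [C _]; have [_ [df _]] := C 1%N; exact: df. Qed.

Lemma test_derive_continuous (R : realType) (phi : R * R -> R) v :
  test_function phi -> continuous ('D_v phi).
Proof. by move=> [C _]; have [_ [_ Df]] := C 1%N; have [c _] := Df v; exact: c. Qed.

Lemma H1per_weak_gradient (R : realType) (u : H1per R) :
  weak_gradient_int (fn u) (grad u).
Proof.
move=> phi tphi i; have [n hn] := test_support tphi; split.
- apply: (@periodic_mul_integrable _ n); [exact: fn_periodic|exact: fn_L2| |].
    exact: test_derive_continuous.
  by move=> x /hn[_]; exact.
- apply: (@periodic_mul_integrable _ n _ phi); [|exact: grad_L2| |].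
  + by move=> x; have [-> ->] := grad_periodic u x.
  + exact: test_continuous.
  + by move=> x /hn[].
- exact: grad_weak.
Qed.

(** Transport the test function instead of u: test the equation for u with
    psi o dilate^-1 and change variables on both sides.  The factor l of the
    gradient is the one by which the derivative of the test function shrinks. *)
Lemma weak_gradient_int_dilate (R : realType) (l : R) b u (g : R * R -> 'cV[R]_2) :
  0 < l -> measurable_fun [set: plane R] u ->
  (forall i, measurable_fun [set: plane R] (fun x => g x i 0)) ->
  weak_gradient_int u g ->
  weak_gradient_int (u \o dilate l b) (fun x => l *: g (dilate l b x)).
Proof.
move=> l0 mu mg wug psi tpsi i.
have l0' : l != 0 by rewrite gt_eqF.
pose phi := psi \o dilate_inv l b.
have tphi : test_function phi.
  by apply: test_function_dilate => //; rewrite invr_eq0.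
have [iu ig E] := wug _ tphi i.
have phiE x : phi (dilate l b x) = psi x by rewrite /phi/= dilateK.
have DphiE x : 'D_(dirvec R i) phi (dilate l b x) = l^-1 * 'D_(dirvec R i) psi x.
  rewrite /phi derive_dilate -/(dilate_inv l b _) dilateK// derive_scale//.
  exact: test_derivable.
have mphi := continuous_measurable2 (test_continuous tphi).
have mDphi := continuous_measurable2 (@test_derive_continuous _ _ (dirvec R i) tphi).
have mf1 : measurable_fun setT (fun x : plane R => u x * 'D_(dirvec R i) phi x).
  exact: measurable_funM.
have mf2 : measurable_fun setT (fun x : plane R => g x i 0 * phi x).
  exact: measurable_funM.
have iu' := proj1 (integrable_dilate b l0 measurableT mf1) iu.
have ig' := proj1 (integrable_dilate b l0 measurableT mf2) ig.
rewrite preimage_setT in iu' ig'.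
have hu : (fun x => (u (dilate l b x) * 'D_(dirvec R i) psi x)%:E) =
    (fun x => l%:E * (u (dilate l b x) * 'D_(dirvec R i) phi (dilate l b x))%:E)%E.
  by apply/funext => x; rewrite DphiE -EFinM mulrCA; congr (_ * _)%:E; rewrite mulVKf.
have hg : (fun x => ((l *: g (dilate l b x)) i 0 * psi x)%:E) =
    (fun x => l%:E * (g (dilate l b x) i 0 * phi (dilate l b x))%:E)%E.
  by apply/funext => x; rewrite mxE phiE -EFinM mulrA.
split.
- by rewrite [X in integrable _ _ X]hu; apply: integrableZl.
- by rewrite [X in integrable _ _ X]hg; apply: integrableZl.
move: E; rewrite (Rintegral_dilate b l0 measurableT mf1 iu).
rewrite (Rintegral_dilate b l0 measurableT mf2 ig) !preimage_setT -mulrN.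
move/(mulfI (expf_neq0 2 l0')) => E.
rewrite /Rintegral hu hg.
rewrite -[in LHS]/(\int[leb2 R]_x
  (l * (u (dilate l b x) * 'D_(dirvec R i) phi (dilate l b x)))).
rewrite -[in RHS]/(\int[leb2 R]_x (l * (g (dilate l b x) i 0 * phi (dilate l b x)))).
by rewrite !RintegralZl// E mulrN.
Qed.

Lemma weak_gradient_intZ (R : realType) (c : R) u (g : R * R -> 'cV[R]_2) :
  weak_gradient_int u g ->
  weak_gradient_int (fun x => c * u x) (fun x => c *: g x).
Proof.
move=> wug phi tphi i; have [iu ig E] := wug _ tphi i.
have hu : (fun x => (c * u x * 'D_(dirvec R i) phi x)) =
    (fun x => c * (u x * 'D_(dirvec R i) phi x)).
  by apply/funext => x; rewrite mulrA.
have hg : (fun x => ((c *: g x) i 0 * phi x)) =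
    (fun x => c * (g x i 0 * phi x)).
  by apply/funext => x; rewrite mxE mulrA.
split.
- under eq_fun do rewrite -mulrA EFinM; exact: integrableZl.
- under eq_fun do rewrite mxE -mulrA EFinM; exact: integrableZl.
- by rewrite hu hg !RintegralZl// E mulrN.
Qed.

Lemma weak_gradient_intD (R : realType) u v (g h : R * R -> 'cV[R]_2) :
  weak_gradient_int u g -> weak_gradient_int v h ->
  weak_gradient_int (fun x => u x + v x) (fun x => g x + h x).
Proof.
move=> wug wvh phi tphi i.
have [iu ig E] := wug _ tphi i; have [iv ih F] := wvh _ tphi i.
split.
- under eq_fun do rewrite mulrDl EFinD; exact: integrableD.
- under eq_fun do rewrite mxE mulrDl EFinD; exact: integrableD.
under eq_Rintegral do rewrite mulrDl.
under [in RHS]eq_Rintegral do rewrite mxE mulrDl.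
by rewrite !RintegralD// E F opprD.
Qed.

Lemma weak_gradient_int0 (R : realType) :
  weak_gradient_int (fun=> 0 : R) (fun=> 0).
Proof.
move=> phi tphi i.
have i0 : (leb2 R).-integrable setT (fun=> 0%E) by exact: integrable0.
split.
- by under eq_fun do rewrite mul0r.
- by under eq_fun do rewrite mxE mul0r.
under eq_Rintegral do rewrite mul0r.
under [in RHS]eq_Rintegral do rewrite mxE mul0r.
by rewrite /Rintegral integral0 oppr0.
Qed.

Lemma weak_gradient_int_sum (R : realType) (I : Type) (s : seq I) u
    (g : I -> R * R -> 'cV[R]_2) :
  (forall i, weak_gradient_int (u i) (g i)) ->
  weak_gradient_int (fun x => \sum_(i <- s) u i x) (fun x => \sum_(i <- s) g i x).
Proof.
move=> h; elim: s => [|i s IH].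
  have -> : (fun x => \sum_(i <- [::]) u i x) = (fun=> 0).
    by apply/funext => x; rewrite big_nil.
  have -> : (fun x => \sum_(i <- [::]) g i x) = (fun=> 0).
    by apply/funext => x; rewrite big_nil.
  exact: weak_gradient_int0.
have -> : (fun x => \sum_(i <- i :: s) u i x) = (fun x => u i x + \sum_(i <- s) u i x).
  by apply/funext => x; rewrite big_cons.
have -> : (fun x => \sum_(i <- i :: s) g i x) = (fun x => g i x + \sum_(i <- s) g i x).
  by apply/funext => x; rewrite big_cons.
exact: weak_gradient_intD.
Qed.

(** * Oscillating and folded periodic Sobolev functions *)

Lemma dilate_osc (R : realType) (eps : R) (b x : R * R) : eps != 0 ->
  dilate eps^-1 0 (dilate eps (eps *: b) x) = x + b.
Proof.
by move=> e0; rewrite /dilate add0r scalerDr !scalerA mulVf// !scale1r addrC.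
Qed.

Lemma periodic_shiftD (R : realType) (X : Type) (f : R * R -> X) (z : int * int) x :
  periodic2 f -> f (x + (z.1%:~R, z.2%:~R)) = f x.
Proof. exact: periodic_shift. Qed.

Lemma dilate_grid_pt (R : realType) (eps : R) (z : int * int) n (s : 'I_n * 'I_n) :
  dilate eps (eps *: (z.1%:~R, z.2%:~R)) (grid_pt R s) =
  eps *: ((z.1 + Posz s.1)%:~R, (z.2 + Posz s.2)%:~R).
Proof.
by rewrite /dilate -scalerDr; congr (_ *: _); rewrite !rmorphD/= -!pmulrn.
Qed.

(** An eps-periodic function looks the same on every cell of the eps-grid. *)
Lemma tile_osc (R : realType) (X : Type) (f : R * R -> X) (eps : R) (z : int * int)
    n (s : 'I_n * 'I_n) x : eps != 0 -> periodic2 f ->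
  f (dilate eps^-1 0
      (dilate eps (dilate eps (eps *: (z.1%:~R, z.2%:~R)) (grid_pt R s)) x)) = f x.
Proof.
move=> e0 pf; rewrite dilate_grid_pt dilate_osc//.
exact: (periodic_shiftD (z.1 + Posz s.1, z.2 + Posz s.2)).
Qed.

Lemma periodic_integrable_box (R : realType) (f : R * R -> R) (eps : R) (z : int * int) n :
  0 < eps -> periodic2 f -> measurable_fun [set: plane R] f ->
  (leb2 R).-integrable (@Omega R) (fun x => (f x)%:E) ->
  (leb2 R).-integrable (box (eps *: (z.1%:~R, z.2%:~R)) (eps * n%:R))
    (fun x => (f (dilate eps^-1 0 x))%:E).
Proof.
move=> e0 pf mf intf; have e0' : eps != 0 by rewrite gt_eqF.
apply: (@integrable_tile _ _ _ _ (fun x => f (dilate eps^-1 0 x))) => // [|s].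
  exact: measurable_comp_dilate.
by under eq_fun do rewrite tile_osc//.
Qed.

(** The average of an eps-periodic function over a square made of whole eps-cells
    is its average over one period. *)
Lemma periodic_integral_box (R : realType) (f : R * R -> R) (eps : R) (z : int * int) n :
  0 < eps -> periodic2 f -> measurable_fun [set: plane R] f ->
  (leb2 R).-integrable (@Omega R) (fun x => (f x)%:E) ->
  \int[leb2 R]_(x in box (eps *: (z.1%:~R, z.2%:~R)) (eps * n%:R)) f (dilate eps^-1 0 x)
  = (eps * n%:R) ^+ 2 * \int[leb2 R]_(x in @Omega R) f x.
Proof.
move=> e0 pf mf intf; have e0' : eps != 0 by rewrite gt_eqF.
rewrite (@Rintegral_tile _ _ _ _ (fun x => f (dilate eps^-1 0 x)))//; last 2 first.
- exact: measurable_comp_dilate.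
- by move=> s; under eq_fun do rewrite tile_osc//.
rewrite exprMn -[RHS]mulrA; congr (_ * _).
under eq_bigr => s _ do under eq_Rintegral do rewrite tile_osc//.
by rewrite sumr_const card_prod card_ord -[LHS]mulr_natl natrM expr2.
Qed.

Lemma OmegaE_tile (R : realType) (eps : R) (M : nat) : eps * M%:R = 1 ->
  @Omega R = box (eps *: (0%:~R, 0%:~R)) (eps * M%:R).
Proof. by move=> ->; rewrite OmegaE; congr box; rewrite -[(_, _)]/(0 : R * R) scaler0. Qed.

Lemma sqr_integrable_osc (R : realType) (f : R * R -> R) (eps : R) (M : nat) :
  0 < eps -> eps * M%:R = 1 -> periodic2 f -> sqr_integrable f ->
  sqr_integrable (fun x => f (dilate eps^-1 0 x)).
Proof.
move=> e0 eM pf [mf intf]; split; first exact: measurable_comp_dilate.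
rewrite (OmegaE_tile eM).
apply: (@periodic_integrable_box _ (fun x => f x ^+ 2) _ (0, 0)) => //.
  by move=> x; have [-> ->] := pf x.
exact: measurable_funX.
Qed.

(** The cell of side eps with corner eps s lies inside the unit cell. *)
Lemma sqr_integrable_zoom (R : realType) (f : R * R -> R) (eps : R) (M : nat)
    (s : 'I_M * 'I_M) :
  0 < eps -> eps * M%:R = 1 -> sqr_integrable f ->
  sqr_integrable (fun x => f (dilate eps (dilate eps 0 (grid_pt R s)) x)).
Proof.
move=> e0 eM [mf intf]; split; first exact: measurable_comp_dilate.
have mf2 : measurable_fun setT (fun x : plane R => f x ^+ 2) by exact: measurable_funX.
have mb := measurable_box (dilate eps 0 (grid_pt R s)) eps.
rewrite -(dilate_preimage_box (dilate eps 0 (grid_pt R s)) e0).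
apply: (proj1 (integrable_dilate _ e0 mb mf2)).
apply: integrableS intf => //.
rewrite OmegaE /box dilateE/= => x; rewrite !add0r/= !in_itv/=.
have aux (i : 'I_M) (y : R) : eps * i%:R <= y <= eps * i%:R + eps -> 0 <= y <= 1.
  move=> /andP[h1 h2]; apply/andP; split.
    by apply: le_trans h1; rewrite mulr_ge0// ltW.
  apply: (@le_trans _ _ (eps * M%:R)); last by rewrite eM.
  rewrite (le_trans h2)// (_ : eps * i%:R + eps = eps * i.+1%:R).
    by rewrite ler_pM2l// ler_nat.
  by rewrite -natr1 mulrDr mulr1.
by move=> [/aux h1 /aux h2].
Qed.

Lemma sum_cyclic (V : nmodType) (F : nat -> V) n :
  F n = F 0%N -> \sum_(i < n) F i.+1 = \sum_(i < n) F i.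
Proof.
case: n => [|n] Fn; first by rewrite !big_ord0.
by rewrite big_ord_recr/= big_ord_recl/= Fn addrC.
Qed.

(** Moving by 1 in the fast variable shifts the grid index by one; the term that
    leaves the grid reappears at the other end since f has period 1. *)
Lemma fold_periodic (R : realType) (V : nmodType) (f : R * R -> V) (eps : R) (M : nat) :
  eps * M%:R = 1 -> periodic2 f ->
  periodic2 (fun x => \sum_(s : 'I_M * 'I_M) f (dilate eps (dilate eps 0 (grid_pt R s)) x)).
Proof.
move=> eM pf x.
pose F (a b : R) (i j : nat) := f (eps * (i%:R + a), eps * (j%:R + b)).
have FE a b : \sum_(s : 'I_M * 'I_M) f (dilate eps (dilate eps 0 (grid_pt R s)) (a, b)) =
    \sum_(i < M) \sum_(j < M) F a b i j.
  rewrite pair_bigA/=; apply: eq_bigr => -[i j] _ /=.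
  by rewrite /F /grid_pt !dilateE/= !add0r !mulrDr.
have eM1 a : eps * (M%:R + a) = eps * a + 1 by rewrite mulrDr eM addrC.
case: x => a b /=; rewrite !FE; split.
- rewrite exchange_big [RHS]exchange_big/=; apply: eq_bigr => j _.
  rewrite -[RHS](@sum_cyclic _ (fun i => F a b i j)).
    by apply: eq_bigr => i _; rewrite /F -natr1 addrA addrAC.
  by rewrite /F eM1 add0r; exact: (proj1 (pf (eps * a, _))).
- apply: eq_bigr => i _.
  rewrite -[RHS](@sum_cyclic _ (fun j => F a b i j)).
    by apply: eq_bigr => j _; rewrite /F -natr1 addrA addrAC.
  by rewrite /F eM1 add0r; exact: (proj2 (pf (_, eps * b))).
Qed.

(** The rescaled cell function w^eps.  The factor eps makes its gradient a pure
    rescaling of the gradient of w. *)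
Lemma H1per_osc (R : realType) (eps : R) (M : nat) (w : H1per R) :
  0 < eps -> eps * M%:R = 1 ->
  exists2 we : H1per R, fn we = (fun x => eps * fn w (dilate eps^-1 0 x)) &
    grad we = (fun x => grad w (dilate eps^-1 0 x)).
Proof.
move=> e0 eM; have e0' : eps != 0 by rewrite gt_eqF.
have per (X : Type) (f : R * R -> X) :
    periodic2 f -> periodic2 (fun x => f (dilate eps^-1 0 x)).
  move=> pf [a b]; rewrite !dilateE /= !add0r !mulrDr mulr1.
  have Me : eps^-1 = M%:R by apply: (mulfI e0'); rewrite eM mulfV.
  split.
    by rewrite -[RHS](periodic_shift M 0 _ pf)/= addr0 Me.
  by rewrite -[RHS](periodic_shift 0 M _ pf)/= addr0 Me.
have mg i : measurable_fun [set: plane R] (fun x => grad w x i 0).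
  by have [] := grad_L2 w i.
have [mf _] := fn_L2 w.
have wg : weak_gradient_int (fun x => eps * fn w (dilate eps^-1 0 x))
    (fun x => grad w (dilate eps^-1 0 x)).
  have := weak_gradient_intZ eps (weak_gradient_int_dilate 0 (_ : 0 < eps^-1) mf mg
    (H1per_weak_gradient w)).
  rewrite invr_gt0 => /(_ e0).
  have -> // : (fun x => eps *: (eps^-1 *: grad w (dilate eps^-1 0 x))) =
    (fun x => grad w (dilate eps^-1 0 x)).
  by apply/funext => x; rewrite scalerA mulfV// scale1r.
unshelve eexists (@MkH1per R (fun x => eps * fn w (dilate eps^-1 0 x))
  (fun x => grad w (dilate eps^-1 0 x)) _ _ _ _ _) => //.
- apply: (per _ (fun x => eps * fn w x)) => x.
  by have [-> ->] := fn_periodic w x.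
- by apply: per; exact: grad_periodic.
- apply: sqr_integrableZ; apply: sqr_integrable_osc e0 eM _ (fn_L2 w).
  exact: fn_periodic.
- move=> i; apply: (sqr_integrable_osc e0 eM _ (grad_L2 w i)).
  by move=> x; have [-> ->] := grad_periodic w x.
- by move=> phi tphi i; have [] := wg _ tphi i.
Qed.

(** Superposing the M x M cells of side eps turns a 1-periodic function of the
    slow variable into a 1-periodic function of the fast variable, which is then
    admissible in the cell problem.  The witness is
    eps^-1 sum_s q (eps (y + s)). *)
Lemma H1per_fold (R : realType) (eps : R) (M : nat) (q : H1per R) :
  0 < eps -> eps * M%:R = 1 ->
  exists p : H1per R, grad p =
    (fun x => \sum_(s : 'I_M * 'I_M) grad q (dilate eps (dilate eps 0 (grid_pt R s)) x)).
Proof.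
move=> e0 eM; have e0' : eps != 0 by rewrite gt_eqF.
have mg : forall i, measurable_fun [set: plane R] (fun x => grad q x i 0).
  by move=> i; have [] := grad_L2 q i.
have [mf _] := fn_L2 q.
pose f x := eps^-1 * \sum_(s : 'I_M * 'I_M) fn q (dilate eps (dilate eps 0 (grid_pt R s)) x).
pose g x := \sum_(s : 'I_M * 'I_M) grad q (dilate eps (dilate eps 0 (grid_pt R s)) x).
have wg : weak_gradient_int f g.
  have := weak_gradient_intZ eps^-1 (weak_gradient_int_sum (index_enum _)
    (fun s : 'I_M * 'I_M => weak_gradient_int_dilate (dilate eps 0 (grid_pt R s)) e0 mf mg
    (H1per_weak_gradient q))).
  congr weak_gradient_int; apply/funext => x.
  by rewrite scaler_sumr; apply: eq_bigr => s _; rewrite scalerA mulVf// scale1r.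
unshelve eexists (@MkH1per R f g _ _ _ _ _) => //.
- by move=> x; have [e1 e2] := fold_periodic eM (@fn_periodic _ q) x; rewrite /f e1 e2.
- exact: (fold_periodic eM (@grad_periodic _ q)).
- apply: sqr_integrableZ; apply: sqr_integrable_sum => s.
  exact: sqr_integrable_zoom (fn_L2 q).
- move=> i; have -> : (fun x => g x i 0) = (fun x => \sum_(s : 'I_M * 'I_M)
     (grad q (dilate eps (dilate eps 0 (grid_pt R s)) x)) i 0).
    by apply/funext => x; rewrite /g summxE.
  apply: sqr_integrable_sum => s.
  exact: sqr_integrable_zoom (grad_L2 q i).
- by move=> phi tphi i; have [] := wg _ tphi i.
Qed.

(** * Affine functions *)

Lemma Rintegral_translate (R : realType) (b : R * R) (D : set (plane R)) (f : plane R -> R) :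
  measurable D -> measurable_fun setT f ->
  \int[leb2 R]_(x in D) f x = \int[leb2 R]_(x in dilate 1 b @^-1` D) f (dilate 1 b x).
Proof.
move=> mD mf; rewrite /Rintegral (integral_dilate b ltr01)//.
  by rewrite expr1n mul1e.
by apply: measurable_funTS; apply/measurable_EFinP.
Qed.

Lemma affine_measurable (R : realType) (p : R * R -> R) :
  affine p -> measurable_fun [set: plane R] p.
Proof.
move=> [a [b [c pE]]]; have -> : p = (fun x => a + b * x.1 + c * x.2) by apply/funext.
apply: measurable_funD; last exact: (measurable_funM (measurable_cst c) measurable_snd).
by apply: measurable_funD => //; exact: (measurable_funM (measurable_cst b) measurable_fst).
Qed.

Lemma affine_dilate (R : realType) (l : R) (b : R * R) (p : R * R -> R) :
  affine p -> affine (p \o dilate l b).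
Proof.
move=> [a [u [v pE]]]; exists (a + u * b.1 + v * b.2), (u * l), (v * l) => x /=.
rewrite pE dilateE/=; ring.
Qed.

Lemma affineB (R : realType) (p r : R * R -> R) :
  affine p -> affine r -> affine (fun x => p x - r x).
Proof.
move=> [a [u [v pE]]] [a' [u' [v' rE]]]; exists (a - a'), (u - u'), (v - v') => x.
rewrite pE rE; ring.
Qed.

Lemma bounded_sqr_integrable (R : realType) (M : R) (p : R * R -> R) :
  measurable_fun [set: plane R] p -> (forall x, Omega x -> `|p x| <= M) ->
  sqr_integrable p.
Proof.
move=> mp pM; split => //; under eq_fun do rewrite expr2 -[X in _ * X]mulr1.
have aeM : {ae leb2 R, forall x, Omega x -> `|p x| <= M} by exact: aeW.
apply: (integrable_aebounded_mul mp aeM).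
  by apply: measurable_funM => //; exact: measurable_cst.
apply: (integrable_aebounded_mul mp aeM); first exact: measurable_cst.
exact: (sqr_integrable_integrable (sqr_integrable_cst 1)).
Qed.

Lemma affine_sqr_integrable (R : realType) (p : R * R -> R) :
  affine p -> sqr_integrable p.
Proof.
move=> ap; have [a [u [v pE]]] := ap.
apply: (@bounded_sqr_integrable _ (`|a| + `|u| + `|v|)).
  exact: affine_measurable.
move=> x; rewrite OmegaE /box/= !in_itv/= !add0r => -[/andP[x0 x1] /andP[y0 y1]].
have ux : `|u * x.1| <= `|u| by rewrite normrM ler_piMr// ger0_norm.
have vx : `|v * x.2| <= `|v| by rewrite normrM ler_piMr// ger0_norm.
rewrite pE (le_trans (ler_normD _ _))// lerD//.
by rewrite (le_trans (ler_normD _ _))// lerD.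
Qed.

(** An affine function with vanishing square integral is zero almost everywhere,
    hence somewhere in each of three small squares at corners of a box inside
    T.  Three such points are never collinear, so the function is zero. *)
Lemma affine_eq0 (R : realType) (T : set (plane R)) (b : R * R) (l : R) (r : R * R -> R) :
  0 < l -> measurable T -> box b l `<=` T -> affine r ->
  (\int[leb2 R]_(x in T) (r x ^+ 2)%:E = 0)%E -> forall x, r x = 0.
Proof.
move=> l0 mT bT ar int0.
have mr : measurable_fun setT (fun x : plane R => (r x ^+ 2)%:E).
  apply/measurable_EFinP; apply: measurable_funX; exact: affine_measurable.
have zero (c : R * R) : box c (l / 4) `<=` box b l -> exists2 x, box c (l / 4) x & r x = 0.
  move=> cb; apply: contrapT => nz.
  have : ae_eq (leb2 R) T (fun x => (r x ^+ 2)%:E) (cst 0%E).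
    apply/ae_eq_integral_abs => //; first exact: measurable_funTS.
    rewrite -[RHS]int0; apply: eq_integral => x _.
    by rewrite gee0_abs// lee_fin sqr_ge0.
  move=> [N [mN N0 subN]].
  have l40 : 0 <= l / 4 by lra.
  have : ((leb2 R) (box c (l / 4)) <= 0)%E.
    rewrite -N0; apply: le_measure.
    - by apply/mem_set; exact: measurable_box.
    - exact: mem_set.
    move=> x cx; apply: subN => /= H; apply: nz; exists x => //.
    have /H [] : T x by exact/bT/cb.
    by move=> /eqP; rewrite sqrf_eq0 => /eqP.
  by rewrite leb2_box// lee_fin leNgt exprn_gt0// divr_gt0.
have corner (c : R * R) : b.1 <= c.1 <= b.1 + l * 3 / 4 ->
    b.2 <= c.2 <= b.2 + l * 3 / 4 ->
    exists x, [/\ c.1 <= x.1 <= c.1 + l / 4, c.2 <= x.2 <= c.2 + l / 4 & r x = 0].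
  move=> /andP[u1 u2] /andP[v1 v2].
  have [|x + rx] := zero c.
    move=> x; rewrite /box/= !in_itv/= => -[/andP[? ?] /andP[? ?]].
    by split; apply/andP; split; lra.
  by rewrite /box/= !in_itv/= => -[? ?]; exists x.
have i1 (y : R) : y <= y <= y + l * 3 / 4 by apply/andP; split; lra.
have i2 (y : R) : y <= y + l * 3 / 4 <= y + l * 3 / 4 by apply/andP; split; lra.
have [x1 [/andP[a1 a2] /andP[a3 a4] rx1]] := corner b (i1 _) (i1 _).
have [x2 [/andP[b1 b2] /andP[b3 b4] rx2]] :=
  corner (b.1 + l * 3 / 4, b.2) (i2 _) (i1 _).
have [x3 [/andP[c1 c2] /andP[c3 c4] rx3]] :=
  corner (b.1, b.2 + l * 3 / 4) (i1 _) (i2 _).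
rewrite /= in a1 a2 a3 a4 b1 b2 b3 b4 c1 c2 c3 c4.
move: ar rx1 rx2 rx3 => [a [u [v rE]]]; rewrite !rE => rx1 rx2 rx3.
pose p1 := x2.1 - x1.1; pose p2 := x2.2 - x1.2.
pose q1 := x3.1 - x1.1; pose q2 := x3.2 - x1.2.
have e1 : u * p1 + v * p2 = 0.
  by rewrite /p1 /p2; transitivity ((a + u * x2.1 + v * x2.2) - (a + u * x1.1 + v * x1.2));
    [ring|rewrite rx1 rx2 subrr].
have e2 : u * q1 + v * q2 = 0.
  by rewrite /q1 /q2; transitivity ((a + u * x3.1 + v * x3.2) - (a + u * x1.1 + v * x1.2));
    [ring|rewrite rx1 rx3 subrr].
have hp1 : l / 2 <= p1 by rewrite /p1; lra.
have hq2 : l / 2 <= q2 by rewrite /q2; lra.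
have hp2 : `|p2| <= l / 4 by rewrite ler_norml /p2; apply/andP; split; lra.
have hq1 : `|q1| <= l / 4 by rewrite ler_norml /q1; apply/andP; split; lra.
(* The diagonal entries are at least l/2, the others at most l/4. *)
have det0 : p1 * q2 - p2 * q1 != 0.
  rewrite gt_eqF// subr_gt0; apply: (le_lt_trans (ler_norm _)); rewrite normrM.
  apply: (@le_lt_trans _ _ (l / 4 * (l / 4))); first exact: ler_pM.
  apply: (@lt_le_trans _ _ (l / 2 * (l / 2))); first by nra.
  by apply: ler_pM => //; lra.
have u0 : u = 0.
  apply: (mulIf det0); rewrite mul0r.
  transitivity ((u * p1 + v * p2) * q2 - (u * q1 + v * q2) * p2); first by ring.
  by rewrite e1 e2 !mul0r subrr.
have v0 : v = 0.
  apply: (mulIf det0); rewrite mul0r.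
  transitivity ((u * q1 + v * q2) * p1 - (u * p1 + v * p2) * q1); first by ring.
  by rewrite e1 e2 !mul0r subrr.
move=> x; rewrite rE u0 v0 !mul0r !addr0.
by move: rx1; rewrite u0 v0 !mul0r !addr0.
Qed.

(** * Quasi-interpolation of mesh-periodic functions *)

Lemma measurable_triangle (R : realType) d (H : R) T :
  measurable (triangle d H T : set (plane R)).
Proof.
case: T => z t.
pose s (x : plane R) := x.1 - (node H z).1; pose u (x : plane R) := x.2 - (node H z).2.
pose g (x : plane R) : R := (if d then s x else H - s x) - u x.
have ms : measurable_fun setT s.
  by apply: measurable_funB; [exact: measurable_fst|exact: measurable_cst].
have mu : measurable_fun setT u.
  by apply: measurable_funB; [exact: measurable_snd|exact: measurable_cst].
have mg : measurable_fun setT g.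
  rewrite /g; case: (d) => //=; apply: measurable_funB => //.
  by apply: measurable_funB => //; exact: measurable_cst.
have -> : triangle d H (z, t) =
    square H z `&` (if t then g @^-1` `[0, +oo[ else g @^-1` `]-oo, 0]).
  apply/seteqP; split=> x; rewrite /triangle /g /s /u/=;
    by case: (t); case: (d); rewrite /= in_itv/= ?andbT ?subr_ge0 ?subr_le0.
apply: measurableI; first exact: measurableX.
by case: t; rewrite -[X in measurable X]setTI; apply: mg => //; exact: measurable_itv.
Qed.

Lemma squareE (R : realType) (H : R) z : square H z = box (node H z) H.
Proof. by rewrite /square /box/= !intrD !mulrDl !mul1r. Qed.

Definition addT (k : int * int) (T : (int * int) * bool) : (int * int) * bool :=
  ((T.1.1 + k.1, T.1.2 + k.2), T.2).

Lemma nodeD (R : realType) (H : R) (z k : int * int) :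
  node H (z.1 + k.1, z.2 + k.2) = dilate 1 (node H k) (node H z).
Proof. by rewrite /node dilateE/= !intrD !mulrDl !mul1r; congr pair; rewrite addrC. Qed.

Lemma triangle_translate (R : realType) d (H : R) k T x :
  triangle d H (addT k T) (dilate 1 (node H k) x) <-> triangle d H T x.
Proof.
rewrite /triangle /addT /square /node dilateE/= !in_itv/= !mul1r !intrD !mulrDl !mul1r.
have e (a b c : R) : b + c - (a + b) = c - a by ring.
rewrite !e.
have e1 (a b c : R) : (a + b <= b + c) = (a <= c) by rewrite addrC lerD2l.
have e2 (a b c : R) : (b + c <= a + b + H) = (c <= a + H).
  by rewrite (addrC a) -addrA lerD2l.
by rewrite !e1 !e2.
Qed.

Lemma triangle_preimage (R : realType) d (H : R) z t :
  dilate 1 (node H z) @^-1` triangle d H (z, t) = triangle d H ((0, 0), t).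
Proof.
apply/seteqP; split=> x /=.
  by move=> h; apply/(triangle_translate d H z); rewrite /addT/= !add0r; case: z h.
by move/(triangle_translate d H z); rewrite /addT/= !add0r; case: z.
Qed.

Lemma triangle_sub_Omega (R : realType) d (H : R) t : H <= 1 ->
  triangle d H ((0, 0), t) `<=` @Omega R.
Proof.
move=> H1 x [+ _]; rewrite OmegaE /square /box/= !in_itv/= !add0r !mul0r !mul1r.
by move=> [/andP[a1 a2] /andP[a3 a4]]; split; apply/andP; split=> //; lra.
Qed.

(** A half-size subsquare of the mesh square, at its right-angle corner. *)
Lemma triangle_sup_box (R : realType) d (H : R) t : 0 < H ->
  exists b, box b (H / 2) `<=` triangle d H ((0, 0), t).
Proof.
move=> H0; exists (if d == t then H / 2 else 0, if t then 0 else H / 2) => x.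
rewrite /box /triangle /square/= !in_itv/= !mul0r !add0r !mul1r !subr0.
case: d t => -[] /=; move=> [/andP[a1 a2] /andP[a3 a4]];
 split; [split; apply/andP; split; lra|lra|split; apply/andP; split; lra|lra
 |split; apply/andP; split; lra|lra|split; apply/andP; split; lra|lra].
Qed.

(** The difference r of two projections is itself an admissible test function, so
    the integral of r^2 over T is zero. *)
Lemma L2proj_unique (R : realType) (T : set (plane R)) (b : R * R) l (v p p' : R * R -> R) :
  0 < l -> measurable T -> box b l `<=` T -> T `<=` @Omega R -> sqr_integrable v ->
  affine p -> affine p' ->
  (forall r, affine r -> \int[leb2 R]_(x in T) ((v x - p x) * r x) = 0) ->
  (forall r, affine r -> \int[leb2 R]_(x in T) ((v x - p' x) * r x) = 0) ->
  p = p'.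
Proof.
move=> l0 mT bT TO hv ap ap' hp hp'.
pose r x := p x - p' x.
have ar : affine r by exact: affineB.
have hr := affine_sqr_integrable ar.
have int_mul (f : R * R -> R) : sqr_integrable f ->
    (leb2 R).-integrable T (fun x => (f x * r x)%:E).
  move=> hf; apply: (integrableS _ mT TO); first exact: measurable_Omega.
  exact: sqr_integrable_mul.
have i1 := int_mul _ (sqr_integrableB hv (affine_sqr_integrable ap)).
have i2 := int_mul _ (sqr_integrableB hv (affine_sqr_integrable ap')).
have i3 := int_mul _ hr.
have : \int[leb2 R]_(x in T) (r x ^+ 2) = 0.
  have -> : (fun x => r x ^+ 2) = (fun x => (v x - p' x) * r x - (v x - p x) * r x).
    by apply/funext => x; rewrite /r; ring.
  by rewrite RintegralB// hp// hp'// subrr.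
move=> int0.
have : (\int[leb2 R]_(x in T) (r x ^+ 2)%:E = 0)%E.
  rewrite -[LHS]fineK; first by congr EFin.
  exact: integrable_fin_num.
move=> /(affine_eq0 l0 mT bT ar) r0.
by apply/funext => x; apply/eqP; rewrite -subr_eq0; apply/eqP; exact: r0.
Qed.

(** The projection conditions on T and on its translate correspond to each other
    under p |-> p o dilate; uniqueness makes the chosen solutions correspond,
    and if one condition has no solution, neither has the other. *)
Lemma L2proj_translate (R : realType) (T : set (plane R)) (b : R * R) l (c : R * R)
    (v : R * R -> R) :
  0 < l -> measurable T -> box b l `<=` dilate 1 c @^-1` T ->
  dilate 1 c @^-1` T `<=` @Omega R -> sqr_integrable v ->
  (forall x, v (dilate 1 c x) = v x) ->
  forall x, L2proj T v (dilate 1 c x) = L2proj (dilate 1 c @^-1` T) v x.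
Proof.
move=> l0 mT bT TO hv pv x; rewrite /L2proj.
have [mv _] := hv.
set S := [set p | _]; set S0 := [set p | _].
have mT0 := measurable_dilate_preimage 1 c mT.
have change p r : affine p -> affine r ->
   \int[leb2 R]_(x in T) ((v x - p x) * r x) =
   \int[leb2 R]_(x in dilate 1 c @^-1` T) ((v x - p (dilate 1 c x)) * r (dilate 1 c x)).
  move=> ap ar; rewrite (Rintegral_translate c mT).
    by apply: eq_Rintegral => y _; rewrite pv.
  apply: measurable_funM; last exact: affine_measurable.
  by apply: measurable_funB => //; exact: affine_measurable.
have SS0 p : S p -> S0 (p \o dilate 1 c).
  move=> [ap hp]; split=> [|r ar]; first exact: affine_dilate.
  have := hp (r \o dilate_inv 1 c) (affine_dilate _ _ ar).
  rewrite change//; last exact: affine_dilate.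
  by under eq_Rintegral do rewrite /= dilateK//.
have S0S p : S0 p -> S (p \o dilate_inv 1 c).
  move=> [ap hp]; split=> [|r ar]; first exact: affine_dilate.
  have := hp (r \o dilate 1 c) (affine_dilate _ _ ar).
  rewrite change//; last exact: affine_dilate.
  by under [in X in _ -> X]eq_Rintegral do rewrite /= dilateK//.
have [[p Sp]|nS] := pselect (exists p, S p); last first.
  rewrite xgetPN; last by move=> p Sp; apply: nS; exists p.
  by rewrite xgetPN// => p /S0S Sp; apply: nS; eexists; exact: Sp.
have Sg : S (xget (fun=> 0) S) by exact: xgetI Sp.
rewrite (_ : xget _ S0 = xget (fun=> 0) S \o dilate 1 c)//.
apply: xget_subset1; first exact: SS0.
move=> p1 p2 [a1 h1] [a2 h2].
exact: (L2proj_unique l0 mT0 bT TO hv a1 a2 h1 h2).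
Qed.

Lemma PiH_translate (R : realType) d (H : R) (v : R * R -> R) z t x :
  0 < H -> H <= 1 -> sqr_integrable v ->
  (forall k : int * int, forall y, v (dilate 1 (node H k) y) = v y) ->
  PiH d H v (z, t) (dilate 1 (node H z) x) = PiH d H v ((0, 0), t) x.
Proof.
move=> H0 H1 hv pv; have [b hb] := triangle_sup_box d t H0.
rewrite /PiH -(triangle_preimage d H z t).
apply: (@L2proj_translate _ _ b (H / 2)) => //.
- by rewrite divr_gt0.
- exact: measurable_triangle.
- by rewrite triangle_preimage.
- by rewrite triangle_preimage; exact: triangle_sub_Omega.
Qed.

Lemma star_translate (R : realType) d (H : R) z :
  star d H z = addT z @` star d H (0, 0).
Proof.
apply/seteqP; split=> [T|_ [T + <-]]; rewrite /star/=.
  move=> hT; exists (addT (- z.1, - z.2) T).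
    apply/(triangle_translate d H z); rewrite -nodeD !add0r.
    by case: T z hT => [[a b] t] [z1 z2] /=; rewrite /addT/= !subrK.
  by case: T hT => [[a b] t] _; rewrite /addT/= !subrK.
by move=> /(triangle_translate d H z); rewrite -nodeD !add0r; case: z.
Qed.

Lemma addT_inj k : injective (addT k).
Proof.
by move=> [[a b] t] [[a' b'] t']; rewrite /addT/= => -[/addIr -> /addIr -> ->].
Qed.

Lemma card_fset_set_image (T U : choiceType) (f : T -> U) (A : set T) :
  injective f -> (#|` fset_set (f @` A)| = #|` fset_set A|)%fset.
Proof.
move=> fi; have [fA|nfA] := pselect (finite_set A).
  by rewrite fset_set_image// card_imfset.
rewrite /fset_set; case: pselect => [fA'|_]; last by case: pselect.
exfalso; apply: nfA.
by move: fA'; rewrite (eq_finite_set (inj_card_eq _))//; exact: in2W.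
Qed.

(** The triangles around a node are the translates of those around the origin. *)
Lemma EH_translate (R : realType) d (H : R) (p : (int * int) * bool -> R * R -> R) z :
  (forall T x, p (addT z T) (dilate 1 (node H z) x) = p T x) ->
  (#|` fset_set (star d H z)|)%fset%:R^-1 *
     \sum_(T \in star d H z) p T (node H z) =
  (#|` fset_set (star d H (0, 0))|)%fset%:R^-1 *
     \sum_(T \in star d H (0, 0)) p T (node H (0, 0)).
Proof.
move=> pT; rewrite star_translate card_fset_set_image; last exact: addT_inj.
congr (_ * _); rewrite fsbig_image; last by move=> ? ? _ _; exact: addT_inj.
apply: eq_fsbigr => T _; rewrite -[RHS]pT; congr (p _ _).
by rewrite -nodeD !add0r; case: z {pT}.
Qed.

(** On each triangle f is affine and takes the value c at three vertices; the
    triangles cover the plane. *)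
Lemma P1per_cst (R : realType) d (H : R) (f : R * R -> R) (c : R) :
  0 < H -> P1per d H f -> (forall z, f (node H z) = c) -> forall x, f x = c.
Proof.
move=> H0 [_ _ fT] fc x.
pose z : int * int := (Num.floor (x.1 / H), Num.floor (x.2 / H)).
have [zx zx'] : z.1%:~R * H <= x.1 /\ x.1 <= (z.1 + 1)%:~R * H.
  have /andP[h1 h2] := floor_itv (x.1 / H).
  by split; [rewrite -ler_pdivlMr|rewrite -ler_pdivrMr//; exact: ltW].
have [zy zy'] : z.2%:~R * H <= x.2 /\ x.2 <= (z.2 + 1)%:~R * H.
  have /andP[h1 h2] := floor_itv (x.2 / H).
  by split; [rewrite -ler_pdivlMr|rewrite -ler_pdivrMr//; exact: ltW].
have [t Tx] : exists t, triangle d H (z, t) x.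
  have [h|h] := leP (x.2 - (node H z).2)
    (if d then x.1 - (node H z).1 else H - (x.1 - (node H z).1)).
    by exists true; split => //; rewrite /square/= !in_itv/= zx zx' zy zy'.
  by exists false; split; [rewrite /square/= !in_itv/= zx zx' zy zy'|exact: ltW].
have [p [a [u [v pE]]] fp] := fT (z, t).
have corner (i j : bool) : triangle d H (z, t) (node H (z.1 + i%:Z, z.2 + j%:Z)) ->
    a + u * ((z.1%:~R + i%:R) * H) + v * ((z.2%:~R + j%:R) * H) = c.
  by move=> /fp; rewrite fc pE /node/= !intrD => <-.
have sq (i j : bool) : square H z (node H (z.1 + i%:Z, z.2 + j%:Z)).
  rewrite /square /node/= !in_itv/= !ler_pM2r// !ler_int.
  by rewrite !lerDl !lerD2l; case: i j => -[].
have tri (i j : bool) : (if t then j%:R <= (if d then i%:R else 1 - i%:R) :> R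
    else (if d then i%:R else 1 - i%:R) <= j%:R :> R) ->
    a + u * ((z.1%:~R + i%:R) * H) + v * ((z.2%:~R + j%:R) * H) = c.
  move=> h; apply: corner; split; first exact: sq.
  rewrite /node/= !intrD !mulrDl.
  have e (y y' : R) : y + y' - y = y' by ring.
  rewrite !e -!pmulrn; case: t h {Tx fp} => /=; case: d {fT}.
  - by rewrite ler_pM2r.
  - by rewrite -{2}[H]mul1r -mulrBl ler_pM2r.
  - by rewrite ler_pM2r.
  - by rewrite -{1}[H]mul1r -mulrBl ler_pM2r.
have [uH vH] : u * H = 0 /\ v * H = 0.
  have c00 := tri false false; have c10 := tri true false.
  have c01 := tri false true; have c11 := tri true true.
  rewrite /= in c00 c10 c01 c11.
  case: t c00 c10 c01 c11 {tri corner Tx fp} => /=; case: d {fT sq} => /=;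
    rewrite ?subr0 ?subrr ?lexx ?ler01 => c00 c10 c01 c11.
  - have := c00 isT; have := c10 isT; have := c11 isT; split; lra.
  - have := c00 isT; have := c10 isT; have := c01 isT; split; lra.
  - have := c00 isT; have := c01 isT; have := c11 isT; split; lra.
  - have := c10 isT; have := c01 isT; have := c11 isT; split; lra.
have u0 : u = 0 by move/eqP: uH; rewrite mulf_eq0 (gt_eqF H0) orbF => /eqP.
have v0 : v = 0 by move/eqP: vH; rewrite mulf_eq0 (gt_eqF H0) orbF => /eqP.
(* Evaluate at a vertex: the lower left corner of the square belongs to three of
   the four kinds of triangles, the upper right one to the remaining kind. *)
have ac : a = c.
  have [td|td] := boolP (t || d).
    have := tri false false; rewrite u0 v0 !mul0r !addr0; apply.
    by move: td; case: (t) (d) => -[]; rewrite //= ?subr0 ?ler01.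
  have := tri true true; rewrite u0 v0 !mul0r !addr0; apply.
  by move: td; case: (t) (d) => -[]; rewrite //= subrr ler01.
by rewrite fp// pE u0 v0 !mul0r !addr0.
Qed.

(** Translating by a mesh node permutes the local projections of an H-periodic
    function, so all nodal averages are equal.  Should no finite element function
    have these nodal values, the interpolant is the zero function. *)
Lemma IH_periodic_cst (R : realType) d (H : R) (v : R * R -> R) :
  0 < H -> H <= 1 -> sqr_integrable v ->
  (forall (k : int * int) y, v (dilate 1 (node H k) y) = v y) ->
  exists c : R, forall x, IH d H v x = c.
Proof.
move=> H0 H1 hv pv; rewrite /IH /EH; case: xgetP; last by exists 0.
move=> f _ [fP1 fz].
exists ((#|` fset_set (star d H (0, 0))|)%fset%:R^-1 *
     \sum_(T \in star d H (0, 0)) PiH d H v T (node H (0, 0))).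
apply: (P1per_cst H0 fP1) => z; rewrite fz; apply: EH_translate => -[[a b] t] x.
(* Both sides are the projection on the reference triangle, evaluated at y. *)
pose y := dilate_inv 1 (node H (a, b)) x.
have -> : dilate 1 (node H z) x = dilate 1 (node H (a + z.1, b + z.2)) y.
  rewrite -{1}[x](dilate_invK (node H (a, b)) (oner_neq0 R)) (nodeD H (a, b) z) -/y.
  by rewrite /dilate !scale1r addrA.
rewrite /addT/= PiH_translate//.
by rewrite -(PiH_translate d (a, b) t y H0 H1 hv pv) dilate_invK// oner_neq0.
Qed.

(** * The energy form of the coefficient *)

Definition vec_sqr_integrable (R : realType) (f : R * R -> 'cV[R]_2) : Prop :=
  forall i, sqr_integrable (fun x => f x i 0).

Definition form (R : realType) (A : R * R -> 'M[R]_2) (f g : R * R -> 'cV[R]_2)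
  (x : R * R) : R := dot (A x *m f x) (g x).

Lemma formE (R : realType) (A : R * R -> 'M[R]_2) f g x :
  form A f g x = \sum_i \sum_k A x i k * (f x k 0 * g x i 0).
Proof.
by apply: eq_bigr => i _; rewrite mxE mulr_suml; apply: eq_bigr => k _; rewrite mulrA.
Qed.

Lemma formBl (R : realType) (A : R * R -> 'M[R]_2) f f' g x :
  form A (fun x => f x - f' x) g x = form A f g x - form A f' g x.
Proof.
rewrite !formE -sumrB; apply: eq_bigr => i _; rewrite -sumrB.
by apply: eq_bigr => k _; rewrite !mxE; ring.
Qed.

Lemma formBr (R : realType) (A : R * R -> 'M[R]_2) f g g' x :
  form A f (fun x => g x - g' x) x = form A f g x - form A f g' x.
Proof.
rewrite !formE -sumrB; apply: eq_bigr => i _; rewrite -sumrB.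
by apply: eq_bigr => k _; rewrite !mxE; ring.
Qed.

Lemma form_suml (R : realType) (I : Type) (s : seq I) (A : R * R -> 'M[R]_2) f g x :
  form A (fun x => \sum_(i <- s) f i x) g x = \sum_(i <- s) form A (f i) g x.
Proof.
elim: s => [|i s IH].
  rewrite big_nil formE big1// => i _; rewrite big1// => k _.
  by rewrite big_nil mxE mul0r mulr0.
rewrite big_cons -IH !formE -big_split/=; apply: eq_bigr => j _; rewrite -big_split/=.
by apply: eq_bigr => k _; rewrite big_cons !mxE; ring.
Qed.

Lemma form_measurable (R : realType) (A : R * R -> 'M[R]_2) (f g : R * R -> 'cV[R]_2) :
  (forall i j, measurable_fun [set: plane R] (fun x => A x i j)) ->
  (forall i, measurable_fun [set: plane R] (fun x => f x i 0)) ->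
  (forall i, measurable_fun [set: plane R] (fun x => g x i 0)) ->
  measurable_fun [set: plane R] (form A f g).
Proof.
move=> mA mf mg; rewrite (_ : form A f g =
  (fun x => \sum_i \sum_k A x i k * (f x k 0 * g x i 0))); last first.
  by apply/funext => x; rewrite formE.
apply: measurable_sum => i; apply: measurable_sum => k.
by apply: measurable_funM => //; exact: measurable_funM.
Qed.

Lemma vec_sqr_integrable_measurable (R : realType) (f : R * R -> 'cV[R]_2) :
  vec_sqr_integrable f -> forall i, measurable_fun [set: plane R] (fun x => f x i 0).
Proof. by move=> hf i; have [] := hf i. Qed.

Lemma form_integrable (R : realType) (al be : R) (A : R * R -> 'M[R]_2) f g :
  coefficient al be A -> vec_sqr_integrable f -> vec_sqr_integrable g ->
  (leb2 R).-integrable (@Omega R) (fun x => (form A f g x)%:E).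
Proof.
move=> cA hf hg; have mO := @measurable_Omega R.
have [M hM] := coef_bounded cA.
rewrite (_ : (fun x => _) =
  (fun x => \sum_i \sum_k (A x i k * (f x k 0 * g x i 0))%:E)%E); last first.
  by apply/funext => x; rewrite formE -sumEFin; apply: eq_bigr => i _; rewrite -sumEFin.
apply: integrable_sum => // i _; apply: integrable_sum => // k _.
apply: (@integrable_aebounded_mul _ M).
- exact: coef_measurable cA i k.
- by apply: negligibleS hM => x /= + h; apply => Ox; exact: h.
- by apply: measurable_funM; [have [] := hf k|have [] := hg i].
- exact: sqr_integrable_mul.
Qed.

Lemma form_sym (R : realType) (al be : R) (A : R * R -> 'M[R]_2) f g :
  coefficient al be A -> vec_sqr_integrable f -> vec_sqr_integrable g ->
  \int[leb2 R]_(x in @Omega R) form A f g x = \int[leb2 R]_(x in @Omega R) form A g f x.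
Proof.
move=> cA hf hg; congr fine; apply: ae_eq_integral.
- exact: measurable_Omega.
- apply: measurable_funTS; apply/measurable_EFinP; apply: form_measurable;
    [exact: coef_measurable cA|exact: vec_sqr_integrable_measurable..].
- apply: measurable_funTS; apply/measurable_EFinP; apply: form_measurable;
    [exact: coef_measurable cA|exact: vec_sqr_integrable_measurable..].
apply: negligibleS (coef_symmetric cA) => x /= + h; apply=> Ox; congr EFin.
rewrite !formE exchange_big/=; apply: eq_bigr => k _; apply: eq_bigr => i _.
by rewrite -[in LHS](h Ox) mxE [f _ _ _ * _]mulrC.
Qed.

Lemma Rintegral_formBl (R : realType) (al be : R) (A : R * R -> 'M[R]_2) f f' g :
  coefficient al be A -> vec_sqr_integrable f -> vec_sqr_integrable f' ->
  vec_sqr_integrable g ->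
  \int[leb2 R]_(x in @Omega R) form A (fun x => f x - f' x) g x =
  \int[leb2 R]_(x in @Omega R) form A f g x - \int[leb2 R]_(x in @Omega R) form A f' g x.
Proof.
move=> cA hf hf' hg; under eq_Rintegral do rewrite formBl.
by rewrite RintegralB//; exact: form_integrable cA _ _.
Qed.

Lemma Rintegral_formBr (R : realType) (al be : R) (A : R * R -> 'M[R]_2) f g g' :
  coefficient al be A -> vec_sqr_integrable f -> vec_sqr_integrable g ->
  vec_sqr_integrable g' ->
  \int[leb2 R]_(x in @Omega R) form A f (fun x => g x - g' x) x =
  \int[leb2 R]_(x in @Omega R) form A f g x - \int[leb2 R]_(x in @Omega R) form A f g' x.
Proof.
move=> cA hf hg hg'; under eq_Rintegral do rewrite formBr.
by rewrite RintegralB//; exact: form_integrable cA _ _.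
Qed.

Lemma rescaleE (R : realType) (eps : R) (A : R * R -> 'M[R]_2) x :
  rescale eps A x = A (dilate eps^-1 0 x).
Proof. by rewrite /rescale dilateE/= !add0r ![_ / _]mulrC. Qed.

Lemma Rintegral_sum (R : realType) (I : Type) (s : seq I) (f : I -> R * R -> R) :
  (forall i, (leb2 R).-integrable (@Omega R) (fun x => (f i x)%:E)) ->
  \int[leb2 R]_(x in @Omega R) (\sum_(i <- s) f i x) =
  \sum_(i <- s) \int[leb2 R]_(x in @Omega R) f i x.
Proof.
move=> hf; have mO := @measurable_Omega R.
elim: s => [|i s IH].
  under eq_Rintegral do rewrite big_nil.
  by rewrite big_nil /Rintegral integral0.
under eq_Rintegral do rewrite big_cons.
have iS : (leb2 R).-integrable (@Omega R) (fun x => (\sum_(i <- s) f i x)%:E).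
  by under eq_fun do rewrite -sumEFin; exact: integrable_sum.
rewrite big_cons -IH RintegralD//; exact: hf.
Qed.

Lemma tile_osc0 (R : realType) (X : Type) (f : R * R -> X) (eps : R) n
    (s : 'I_n * 'I_n) x : eps != 0 -> periodic2 f ->
  f (dilate eps^-1 0 (dilate eps (dilate eps 0 (grid_pt R s)) x)) = f x.
Proof.
move=> e0 pf; rewrite -[RHS](tile_osc (0, 0) s x e0 pf).
by rewrite -[(0%:~R, 0%:~R)]/(0 : R * R) scaler0.
Qed.

(** In the local variable y of the cell x = eps (y + s), the factors A_eps and
    g(x/eps) are A(y) and g(y) for every s, so summing over the cells acts on G
    only. *)
Lemma fold_form (R : realType) (al be : R) (A : R * R -> 'M[R]_2) (eps : R) (M : nat)
    (G g : R * R -> 'cV[R]_2) :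
  0 < eps -> eps * M%:R = 1 -> coefficient al be A ->
  vec_sqr_integrable G -> vec_sqr_integrable g -> periodic2 g ->
  \int[leb2 R]_(x in @Omega R)
     dot (rescale eps A x *m G x) (g (dilate eps^-1 0 x)) =
  eps ^+ 2 * \int[leb2 R]_(x in @Omega R) form A
     (fun x => \sum_(s : 'I_M * 'I_M) G (dilate eps (dilate eps 0 (grid_pt R s)) x)) g x.
Proof.
move=> e0 eM cA hG hg pg; have e0' : eps != 0 by rewrite gt_eqF.
have hGs (s : 'I_M * 'I_M) :
    vec_sqr_integrable (fun x => G (dilate eps (dilate eps 0 (grid_pt R s)) x)).
  move=> i; exact: (sqr_integrable_zoom s e0 eM (hG i)).
pose F x := dot (rescale eps A x *m G x) (g (dilate eps^-1 0 x)).
have FE (s : 'I_M * 'I_M) x : F (dilate eps (dilate eps 0 (grid_pt R s)) x) =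
    form A (fun x => G (dilate eps (dilate eps 0 (grid_pt R s)) x)) g x.
  by rewrite /F rescaleE /form (tile_osc0 _ _ e0' (coef_periodic cA)) (tile_osc0 _ _ e0' pg).
have mF : measurable_fun [set: plane R] F.
  have -> : F = form (fun x => A (dilate eps^-1 0 x)) G (fun x => g (dilate eps^-1 0 x)).
    by apply/funext => x; rewrite /F rescaleE.
  apply: form_measurable => [i j|i|i].
  - exact: (measurable_comp_dilate _ _ (coef_measurable cA i j)).
  - exact: vec_sqr_integrable_measurable.
  - exact: (measurable_comp_dilate _ _ (vec_sqr_integrable_measurable hg i)).
have OE : @Omega R = box 0 (eps * M%:R) by rewrite eM OmegaE.
rewrite {1}OE (@Rintegral_tile _ M eps 0 F)//; last first.
  by move=> s; under eq_fun do rewrite FE; exact: form_integrable cA _ _.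
congr (_ * _); under [in RHS]eq_Rintegral do rewrite form_suml.
rewrite Rintegral_sum; last by move=> s; exact: form_integrable cA _ _.
by apply: eq_bigr => s _; under eq_Rintegral do rewrite FE.
Qed.

Lemma periodic_form_square (R : realType) (al be : R) (A : R * R -> 'M[R]_2)
    (eps : R) (m : nat) (f g : R * R -> 'cV[R]_2) z :
  0 < eps -> coefficient al be A ->
  vec_sqr_integrable f -> vec_sqr_integrable g -> periodic2 f -> periodic2 g ->
  \int[leb2 R]_(x in square (m%:R * eps) z)
     dot (rescale eps A x *m f (dilate eps^-1 0 x)) (g (dilate eps^-1 0 x)) =
  (m%:R * eps) ^+ 2 * \int[leb2 R]_(x in @Omega R) form A f g x.
Proof.
move=> e0 cA hf hg pf pg.
have -> : square (m%:R * eps) z =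
    box (eps *: ((z.1 * m%:Z)%:~R, (z.2 * m%:Z)%:~R)) (eps * m%:R).
  rewrite squareE [m%:R * eps]mulrC; congr box; rewrite /node !intrM -!pmulrn.
  transitivity (eps * (z.1%:~R * m%:R), eps * (z.2%:~R * m%:R)); last by [].
  by congr pair; ring.
rewrite [m%:R * eps]mulrC.
rewrite -(@periodic_integral_box _ (form A f g) eps (z.1 * m%:Z, z.2 * m%:Z) m)//.
- by apply: eq_Rintegral => x _; rewrite rescaleE.
- by move=> x; rewrite /form; have [-> ->] := coef_periodic cA x;
    have [-> ->] := pf x; have [-> ->] := pg x.
- by apply: form_measurable; [exact: coef_measurable cA|exact: vec_sqr_integrable_measurable..].
- exact: form_integrable cA _ _.
Qed.

Lemma vec_sqr_integrable_cst (R : realType) (e : 'cV[R]_2) :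
  vec_sqr_integrable (fun=> e).
Proof. by move=> i; exact: sqr_integrable_cst. Qed.

Lemma vec_sqr_integrableB (R : realType) (f g : R * R -> 'cV[R]_2) :
  vec_sqr_integrable f -> vec_sqr_integrable g -> vec_sqr_integrable (fun x => f x - g x).
Proof.
move=> hf hg i; under eq_fun do rewrite !mxE.
exact: sqr_integrableB.
Qed.

(** * Identification of the two coefficients *)

Theorem proposition3p1 (R : realType) (alpha beta : R)
    (A1 : R * R -> 'M[R]_2) (d : bool) (N m : nat) (H eps : R)
    (w : 'I_2 -> H1per R) (q : 'I_N * 'I_N -> 'I_2 -> H1per R) :
  0 < alpha -> alpha <= beta ->
  coefficient alpha beta A1 ->
  (0 < N)%N -> H = N%:R^-1 ->
  0 < eps -> H = m%:R * eps ->
  (forall j, cell_solution A1 j (w j)) ->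
  (forall (Q : 'I_N * 'I_N) j,
     corrector d H (rescale eps A1) (square H (Posz Q.1, Posz Q.2)) j (q Q j)) ->
  forall (Q : 'I_N * 'I_N) (k j : 'I_2),
    numerical_coef (rescale eps A1) (square H (Posz Q.1, Posz Q.2)) (q Q) k j
    = homogenized A1 w k j.
Proof.
move=> _ _ cA N0 HN e0 Hm hw hq Q k j.
have H0 : 0 < H by rewrite HN invr_gt0 ltr0n.
have H1 : H <= 1 by rewrite HN invf_le1 ?ltr0n// ler1n.
(* 1 / eps, the number of eps-cells along a side of Omega. *)
pose M := (m * N)%N.
have eM : eps * M%:R = 1.
  rewrite /M natrM mulrA [eps * _]mulrC -Hm HN mulVf// pnatr_eq0 -lt0n//.
have e0' : eps != 0 by rewrite gt_eqF.
have hgw i : vec_sqr_integrable (grad (w i)) by move=> l; exact: grad_L2.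
have hcst i : vec_sqr_integrable (fun=> evec R i) by exact: vec_sqr_integrable_cst.
have pcst i : periodic2 (fun _ : R * R => evec R i) by [].
(* The two test functions: w_k^eps, and the folded corrector. *)
have [we fwe gwe] := H1per_osc (w k) e0 eM.
have [p gp] := H1per_fold (q Q j) e0 eM.
have hgp : vec_sqr_integrable (grad p) by move=> l; exact: grad_L2.
have [_ hqQ] := hq Q j.
have kwe : kerIH d H we.
  rewrite /kerIH/= fwe; apply: IH_periodic_cst => //.
    by rewrite -fwe; exact: fn_L2.
  move=> z y; congr (_ * _).
  have -> : dilate eps^-1 0 (dilate 1 (node H z) y) =
      dilate eps^-1 0 y + ((z.1 * m%:Z)%:~R, (z.2 * m%:Z)%:~R).
    rewrite !dilateE /node Hm/= !intrM -!pmulrn; congr pair => /=; by field.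
  by rewrite (periodic_shiftD (z.1 * m%:Z, z.2 * m%:Z)) //; exact: fn_periodic.
have E1 : \int[leb2 R]_(x in @Omega R) dot (rescale eps A1 x *m grad (q Q j) x) (evec R k)
   = eps ^+ 2 * \int[leb2 R]_(x in @Omega R) form A1 (grad p) (fun=> evec R k) x.
  rewrite gp -(fold_form e0 eM cA _ (hcst k) (pcst k))// => i; exact: grad_L2.
have E2 : \int[leb2 R]_(x in @Omega R) dot (rescale eps A1 x *m grad (q Q j) x) (grad we x)
   = eps ^+ 2 * \int[leb2 R]_(x in @Omega R) form A1 (grad p) (grad (w k)) x.
  rewrite gp gwe -(fold_form e0 eM cA _ (hgw k) (@grad_periodic _ (w k)))//.
  by move=> i; exact: grad_L2.
have cellk (v : H1per R) :
    \int[leb2 R]_(x in @Omega R) form A1 (grad v) (grad (w k)) x =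
    \int[leb2 R]_(x in @Omega R) form A1 (grad v) (fun=> evec R k) x.
  have hv : vec_sqr_integrable (grad v) by move=> l; exact: grad_L2.
  apply/eqP; rewrite -subr_eq0 -(Rintegral_formBr cA)// (form_sym cA)//; last first.
    exact: vec_sqr_integrableB.
  by apply/eqP; exact: (hw k v).
have E3 : \int[leb2 R]_(x in square H (Posz Q.1, Posz Q.2))
    dot (rescale eps A1 x *m evec R j) (grad we x) =
    H ^+ 2 * \int[leb2 R]_(x in @Omega R) form A1 (fun=> evec R j) (grad (w k)) x.
  rewrite gwe Hm (periodic_form_square _ _ e0 cA (hcst j) (hgw k))//.
  exact: grad_periodic.
have E4 : \int[leb2 R]_(x in square H (Posz Q.1, Posz Q.2))
    dot (rescale eps A1 x *m evec R j) (evec R k) =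
    H ^+ 2 * \int[leb2 R]_(x in @Omega R) form A1 (fun=> evec R j) (fun=> evec R k) x.
  by rewrite Hm (periodic_form_square _ _ e0 cA (hcst j) (hcst k)).
have areaQ : fine ((leb2 R) (square H (Posz Q.1, Posz Q.2))) = H ^+ 2.
  by rewrite squareE leb2_box// ltW.
rewrite !mxE areaQ E4 E1 -cellk -E2 hqQ// E3 -mulrBr.
have H20 : H ^+ 2 != 0 by rewrite expf_neq0// gt_eqF.
rewrite -mulrBr mulKf//.
rewrite -[RHS]/(\int[leb2 R]_(x in @Omega R) form A1 (fun x => evec R j - grad (w j) x)
  (fun x => evec R k - grad (w k) x) x).
rewrite (Rintegral_formBl cA)//; last exact: vec_sqr_integrableB.
by rewrite !(Rintegral_formBr cA)// (cellk (w j)) subrr subr0.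
Qed.
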